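(* Let $M$ be a closed Haken (oriented) 3-manifold and let $(\mathcal G,X)$ be the graph of groups associated to its JSJ decomposition, so that $\pi_1(M)=\pi_1(\mathcal G,X)$. Suppose $(\mathcal C,\mu)$ and $(\mathcal C',\mu')$ are cyclically reduced forms whose labels $\omega$ and $\omega'$ are conjugate in $\pi_1(M)$. Then $(\mathcal C,\mu)$ and $(\mathcal C',\mu')$ have the same length, and moreover one of the following holds: (i) Their length is $0$, $\mathcal C=\mathcal C'=(v_{\sigma_1})$ is a single vertex, and $\omega,\omega'$ are conjugate in $G(v_{\sigma_1})$. (ii) Their length is $0$, and there exist a path $(v_{\alpha_0},e_{\beta_1},\ldots,e_{\beta_p},v_{\alpha_p})$ in $X$ and a sequence $(c_1,\ldots,c_p)$ with $c_i\in G(e_{\beta_i})$ for all $i=1,\ldots,p$, such that $\omega\in G(v_{\alpha_0})$, $\omega'\in G(v_{\alpha_p})$, $\omega$ is conjugate to $c_1^-$ in $G(v_{\alpha_0})$, $\omega'$ is conjugate to $c_p^+$ in $G(v_{\alpha_p})$, and for all $i=1,\ldots,p-1$, $c_i^+$ is conjugate to $c_{i+1}^-$ in $G(v_{\alpha_i})$. (iii) Their length is greater than $0$; up to replacing $(\mathcal C',\mu')$ (and correspondingly $\omega'$) by a cyclic conjugate, $\mathcal C=\mathcal C'=(v_{\sigma_1},e_{\tau_1},\ldots,v_{\sigma_n},e_{\tau_n})$, and there is a sequence $(c_1,\ldots,c_n)$ with $c_i\in G(e_{\tau_i})$ such that $$\mu_1=c_n^+\,\mu_1'\,(c_1^-)^{-1}\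 \text{ in } G(v_{\sigma_1}),\qquad \mu_i=c_{i-1}^+\,\mu_i'\,(c_i^-)^{-1}\ \text{ in } G(v_{\sigma_i})\quad (i=2,\ldots,n).$$ In particular $c_n^+\in G(e_{\tau_n})^+$ satisfies $\omega=c_n^+\,\omega'\,(c_n^+)^{-1}$ in $\pi_1(M)$.
   Context: JSJ decomposition: for a closed Haken 3-manifold $M$ there is an essential surface $W\subset M$ (possibly empty), whose components are tori $\mathcal T_1,\ldots,\mathcal T_q$, such that cutting $M$ along $W$ (removing open regular neighbourhoods of the $\mathcal T_j$) gives components $M_1,\ldots,M_n$, the pieces, each Seifert fibered or atoroidal; $W$ is minimal, up to ambient isotopy, among such surfaces. Each $\mathcal T_j$ gives two boundary tori $\mathcal T_j^-,\mathcal T_j^+$ of the cut manifold. Graph of groups $(\mathcal G,X)$: $X$ has one vertex $v_i$ per piece $M_i$, and for each $\mathcal T_j$ two mutually inverse edges $e_j,\bar e_j$; if $\mathcal T_j^-\subset\partial M_k$ and $\mathcal T_j^+\subset\partial M_l$, then $e_j$ has origin $v_k$ and extremity $v_l$. Vertex groups are $G(v_i)=\pi_1(M_i)$, edge groups are $G(e_j)=G(\bar e_j)=\pi_1(\mathcal T_j)\cong\mathbb Z\oplus\mathbb Z$. For each edge $e$ there are monomorphisms $\varphi_e^-$ from $G(e)$ to the group of the origin of $e$ and $\varphi_e^+$ from $G(e)$ to the group of the extremity of $e$, induced by the inclusions of the boundary tori (after choosing base points and connecting paths), with $\varphi_{\bar e}^{\mp}=\varphi_e^{\pm}$. For $c\in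 G(e)$ write $c^{\pm}=\varphi_e^{\pm}(c)$, and $G(e)^{\pm}=\varphi_e^{\pm}(G(e))$. Given a maximal tree $T$ of $X$, $\pi_1(M)\cong\pi_1(\mathcal G,X)$ is generated by the vertex groups and letters $t_e$ ($e$ an edge), subject to the relations of the vertex groups, $t_e\,c^+\,t_e^{-1}=c^-$ for $c\in G(e)$, $t_{\bar e}=t_e^{-1}$, and $t_e=1$ for $e$ in $T$. Vertex groups embed in $\pi_1(M)$. Forms: a word of type $\mathcal C$ is a pair $(\mathcal C,\mu)$ where $\mathcal C=(v_{\sigma_1},e_{\tau_1},v_{\sigma_2},\ldots,e_{\tau_n},v_{\sigma_{n+1}})$ is a based loop in $X$ ($e_{\tau_i}$ has origin $v_{\sigma_i}$ and extremity $v_{\sigma_{i+1}}$, $v_{\sigma_{n+1}}=v_{\sigma_1}$) and $\mu=(\mu_1,\ldots,\mu_{n+1})$ with $\mu_i\in G(v_{\sigma_i})$. Its length is $n$, and its label is $\mu_1t_{e_{\tau_1}}\mu_2t_{e_{\tau_2}}\cdots\mu_nt_{e_{\tau_n}}\mu_{n+1}\in\pi_1(M)$. It is reduced if either $n=0$ and its label is $\neq1$, or $n\ge1$ and whenever $e_{\tau_{i-1}}=\bar e_{\tau_i}$ one has $\mu_i\in G(v_{\sigma_i})\setminus G(e_{\tau_{i-1}})^+$. A cyclic conjugate of $(\mathcal C,\mu)$ is a word $((v_{\sigma_i},e_{\tau_i},\ldots,e_{\tau_n},v_{\sigma_{n+1}},e_{\tau_1},\ldots,e_{\tau_{i-1}},v_{\sigma_i}),(\mu_i,\ldots,\mu_n,\mu_{n+1}\mu_1,\mu_2,\ldots,\mu_{i-1},1))$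 for some $i$. $(\mathcal C,\mu)$ is a cyclically reduced form if all its cyclic conjugates are reduced and, when $n\geq 1$, $\mu_{n+1}=1$; in that case the last vertex and $\mu_{n+1}$ are omitted from the notation, so $\mathcal C=(v_{\sigma_1},e_{\tau_1},\ldots,v_{\sigma_n},e_{\tau_n})$ and $\mu=(\mu_1,\ldots,\mu_n)$. *)

(* Defs.v *)
From HB Require Import structures.
From mathcomp Require Import all_boot all_order all_algebra generic_quotient.
From mathcomp Require Import all_classical all_reals all_analysis.
From mathcomp Require Import lra.
Set Implicit Arguments.
Unset Strict Implicit.
Unset Printing Implicit Defensive.
Import Order.TTheory GRing.Theory Num.Theory.
Import numFieldNormedType.Exports.
Local Open Scope classical_set_scope.
Local Open Scope ring_scope.

(* Paths are functions R -> M used only on [0, 1]; a path in a subset A of M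
   must stay in A, and so must a homotopy (with fixed end points). *)
Section Paths.
Context {R : realType} {M : topologicalType}.
Implicit Types (A : set M) (f g h : R -> M) (phi psi : R -> R).
Local Notation I := (`[0, 1]%classic : set R).

Definition is_path A (x y : M) f :=
  [/\ {within I, continuous f}, f @` I `<=` A, f 0 = x & f 1 = y].

Definition homotopic A f g := exists H : R * R -> M,
  [/\ {within I `*` I, continuous H}, H @` (I `*` I) `<=` A,
      forall t, I t -> H (t, 0) = f t /\ H (t, 1) = g t &
      forall s, I s -> H (0, s) = f 0 /\ H (1, s) = f 1].

Definition cst_path (x : M) : R -> M := fun=> x.
Definition path_inverse f : R -> M := fun t => f (1 - t).
Definition path_concat f g : R -> M :=
  fun t => if t <= 2^-1 then f (2 * t) else g (2 * t - 1).

Lemma I01 (t : R) : I t <-> 0 <= t <= 1.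
Proof. by rewrite /= in_itv. Qed.

Lemma I_0 : I 0. Proof. by apply/I01; rewrite lexx ler01. Qed.
Lemma I_1 : I 1. Proof. by apply/I01; rewrite lexx ler01. Qed.

Lemma within_comp (X Y Z : topologicalType) (A : set X) (B : set Y)
    (f : X -> Y) (g : Y -> Z) :
  {within B, continuous g} -> {within A, continuous f} -> f @` A `<=` B ->
  {within A, continuous (g \o f)}.
Proof.
move=> /subspace_continuousP cg /subspace_continuousP cf fAB.
apply/subspace_continuousP => x Ax.
have Bfx : B (f x) by apply: fAB; exists x.
apply: (cvg_trans _ (cg _ Bfx)) => U /= nU.
have := cf x Ax _ nU; rewrite /within /= !nbhs_simpl /=; apply: filterS => y yU Ay.
by apply: (yU Ay); apply: fAB; exists y.
Qed.

Lemma paste (X Y : topologicalType) (A B : set X) (f g h : X -> Y) :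
  closed A -> closed B ->
  {within A, continuous f} -> {within B, continuous g} ->
  (forall x : X, A x -> h x = f x) -> (forall x : X, B x -> h x = g x) ->
  {within A `|` B, continuous h}.
Proof.
move=> cA cB cf cg hf hg; apply: withinU_continuous => //.
- by apply: (subspace_eq_continuous _ cf) => x /set_mem Ax /=; exact/esym/hf.
- by apply: (subspace_eq_continuous _ cg) => x /set_mem Ax /=; exact/esym/hg.
Qed.

Lemma continuous_comb (phi psi : R * R -> R) :
  continuous phi -> continuous psi -> continuous (fun z => (phi z, psi z)).
Proof. by move=> cf cg z; exact: (cvg_pair (cf z) (cg z)). Qed.

Lemma homotopic_refl A x y f : is_path A x y f -> homotopic A f f.
Proof.
move=> [cf fA f0 f1]; exists (f \o fst); split => //.
- apply: (within_comp cf).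
    by apply: continuous_subspaceT => z; exact: cvg_fst.
  by move=> _ [[t s] [It _] <-].
- by move=> _ [[t s] [It _] <-]; apply: fA; exists t.
Qed.

Lemma homotopic_sub (H : R * R -> M) (phi : R * R -> R * R)
    (D : set (R * R)) A :
  {within I `*` I, continuous H} -> H @` (I `*` I) `<=` A ->
  {within D, continuous phi} -> phi @` D `<=` I `*` I ->
  {within D, continuous (H \o phi)} /\ (H \o phi) @` D `<=` A.
Proof.
move=> cH HA cphi phiD; split; first exact: (within_comp cH).
by move=> _ [z Dz <-]; apply: HA; exists (phi z) => //; apply: phiD; exists z.
Qed.

Lemma homotopic_sym A f g : homotopic A f g -> homotopic A g f.
Proof.
move=> [H [cH HA Hfg He]].
have c : continuous (fun z : R * R => (z.1, 1 - z.2)).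
  apply: continuous_comb => z; first exact: cvg_fst.
  by apply: cvgB; [exact: cvg_cst|exact: cvg_snd].
have [||cK KA] := @homotopic_sub H (fun z => (z.1, 1 - z.2)) (I `*` I) A cH HA.
- exact: continuous_subspaceT.
- by move=> _ [[t s] [/I01 /= It /I01 /= Is] <-]; split; apply/I01 => //=; lra.
exists (H \o (fun z => (z.1, 1 - z.2))); split => //= [t /Hfg[h0 h1]|s /I01 s01].
  by rewrite subr0 subrr.
have /He[-> ->] : I (1 - s) by apply/I01; lra.
by have [_ <-] := Hfg 0 I_0; have [_ <-] := Hfg 1 I_1;
  have [-> ->] := He 1 I_1.
Qed.

Lemma closed_rect (D E : set R) : closed D -> closed E ->
  closed (D `*` E : set (R * R)).
Proof.
move=> cD cE; apply: (@closedI _ (fst @^-1` D) (snd @^-1` E)).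
  by apply: closed_comp => // z _; exact: cvg_fst.
by apply: closed_comp => // z _; exact: cvg_snd.
Qed.

Lemma homotopic_trans A f g h :
  homotopic A f g -> homotopic A g h -> homotopic A f h.
Proof.
move=> [H [cH HA Hfg He]] [K [cK KA Kgh Ke]].
pose a (z : R * R) := (z.1, 2 * z.2); pose b (z : R * R) := (z.1, 2 * z.2 - 1).
pose D1 : set (R * R) := I `*` `[0, 2^-1]; pose D2 : set (R * R) := I `*` `[2^-1, 1].
have D12 : I `*` I = D1 `|` D2.
  apply/seteqP; split=> [[t s] [It /I01 /= s01]|[t s] []];
    rewrite /D1 /D2 /= ?in_itv /=; last 2 first.
  - by move=> [It s01]; split => //; lra.
  - by move=> [It s01]; split => //; lra.
  - by have [s2|s2] := leP s 2^-1; [left|right]; split => //; lra.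
have [||cHa HaA] := @homotopic_sub H a D1 A cH HA.
- apply: continuous_subspaceT; apply: continuous_comb => z; first exact: cvg_fst.
  by apply: cvgM; [exact: cvg_cst|exact: cvg_snd].
- move=> _ [[t s] [It]] + <-; rewrite /= in_itv /= => Is.
  by split => //=; apply/I01; lra.
have [||cKb KbA] := @homotopic_sub K b D2 A cK KA.
- apply: continuous_subspaceT; apply: continuous_comb => z; first exact: cvg_fst.
  by apply: cvgB; [apply: cvgM; [exact: cvg_cst|exact: cvg_snd]|exact: cvg_cst].
- move=> _ [[t s] [It]] + <-; rewrite /= in_itv /= => Is.
  by split => //=; apply/I01; lra.
pose L (z : R * R) := if z.2 <= 2^-1 then H (a z) else K (b z).
have LH z : D1 z -> L z = H (a z).
  by case: z => t s [It]; rewrite /L /= in_itv /= => /andP[_ ->].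
have LK z : D2 z -> L z = K (b z).
  case: z => t s [It]; rewrite /L /= in_itv /= => /andP[s2 s1].
  case: ifPn => // s3; have -> : s = 2^-1 by apply/le_anti/andP.
  rewrite /a /b /= divff ?pnatr_eq0// subrr.
  by have [_ ->] := Hfg t It; have [->] := Kgh t It.
have fg0 : f 0 = g 0 by have [_ <-] := Hfg 0 I_0; have [-> _] := He 1 I_1.
have fg1 : f 1 = g 1 by have [_ <-] := Hfg 1 I_1; have [_ ->] := He 1 I_1.
exists L; split.
- rewrite D12; apply: (paste _ _ cHa cKb LH LK);
    apply: closed_rect; exact: itv_closed.
- rewrite D12 => _ [z [Dz|Dz] <-].
    by rewrite LH//; apply: HaA; exists z.
  by rewrite LK//; apply: KbA; exists z.
- move=> t It; split.
    by rewrite /L /= ifT ?invr_ge0// /a /= mulr0; have [] := Hfg t It.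
  rewrite /L /= ifF; last by apply/negbTE; lra.
  by rewrite /b /= (_ : 2 * 1 - 1 = 1); [have [] := Kgh t It|lra].
- move=> s /I01 s01; rewrite /L /a /b /=; case: ifPn => s2.
    by apply: He; apply/I01; lra.
  by rewrite fg0 fg1; apply: Ke; apply/I01; lra.
Qed.

Lemma homotopic_reparam A x y f phi psi : is_path A x y f ->
  continuous phi -> continuous psi ->
  phi @` I `<=` I -> psi @` I `<=` I -> phi 0 = psi 0 -> phi 1 = psi 1 ->
  homotopic A (f \o phi) (f \o psi).
Proof.
move=> [cf fA f0 f1] cphi cpsi phiI psiI p0 p1.
pose a (z : R * R) := (1 - z.2) * phi z.1 + z.2 * psi z.1.
have ca : continuous a.
  move=> z; apply: cvgD; apply: cvgM.
  - by apply: cvgB; [exact: cvg_cst|exact: cvg_snd].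
  - by apply: (@continuous_comp _ _ _ fst phi); [exact: cvg_fst|exact: cphi].
  - exact: cvg_snd.
  - by apply: (@continuous_comp _ _ _ fst psi); [exact: cvg_fst|exact: cpsi].
have aI : a @` (I `*` I) `<=` I.
  move=> _ [[t s] [/= It /I01 /= Is] <-]; rewrite /a /=.
  have /I01 pt : I (phi t) by apply: phiI; exists t.
  have /I01 qt : I (psi t) by apply: psiI; exists t.
  by apply/I01; nra.
exists (f \o a); split.
- by apply: (within_comp cf) aI; exact: continuous_subspaceT.
- by move=> _ [z Iz <-]; apply: fA; exists (a z) => //; apply: aI; exists z.
- by move=> t It; rewrite /a /=; split; congr f; lra.
- by move=> s Is; rewrite /a /= p0 p1; split; congr f; lra.
Qed.

Lemma path_reparam A x y f phi : is_path A x y f -> continuous phi ->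
  phi @` I `<=` I -> is_path A (f (phi 0)) (f (phi 1)) (f \o phi).
Proof.
move=> [cf fA f0 f1] cphi phiI; split => //.
  by apply: (within_comp cf) phiI; exact: continuous_subspaceT.
by move=> _ [t It <-]; apply: fA; exists (phi t) => //; apply: phiI; exists t.
Qed.

Lemma homotopic_cat A f g f' g' : f 1 = g 0 ->
  homotopic A f f' -> homotopic A g g' ->
  homotopic A (path_concat f g) (path_concat f' g').
Proof.
move=> fg [H [cH HA Hf He]] [K [cK KA Kg Ke]].
pose a (z : R * R) := (2 * z.1, z.2); pose b (z : R * R) := (2 * z.1 - 1, z.2).
pose D1 : set (R * R) := `[0, 2^-1] `*` I; pose D2 : set (R * R) := `[2^-1, 1] `*` I.
have D12 : I `*` I = D1 `|` D2.
  apply/seteqP; split=> [[t s] [/I01 /= t01 Is]|[t s] []];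
    rewrite /D1 /D2 /= ?in_itv /=; last 2 first.
  - by move=> [t01 Is]; split => //; lra.
  - by move=> [t01 Is]; split => //; lra.
  - by have [t2|t2] := leP t 2^-1; [left|right]; split => //; lra.
have [||cHa HaA] := @homotopic_sub H a D1 A cH HA.
- apply: continuous_subspaceT; apply: continuous_comb => z; last exact: cvg_snd.
  by apply: cvgM; [exact: cvg_cst|exact: cvg_fst].
- move=> _ [[t s] []] + Is <-; rewrite /= in_itv /= => It.
  by split => //=; apply/I01; lra.
have [||cKb KbA] := @homotopic_sub K b D2 A cK KA.
- apply: continuous_subspaceT; apply: continuous_comb => z; last exact: cvg_snd.
  by apply: cvgB; [apply: cvgM; [exact: cvg_cst|exact: cvg_fst]|exact: cvg_cst].
- move=> _ [[t s] []] + Is <-; rewrite /= in_itv /= => It.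
  by split => //=; apply/I01; lra.
pose L (z : R * R) := if z.1 <= 2^-1 then H (a z) else K (b z).
have LH z : D1 z -> L z = H (a z).
  by case: z => t s []; rewrite /L /= in_itv /= => /andP[_ ->].
have LK z : D2 z -> L z = K (b z).
  case: z => t s []; rewrite /L /= in_itv /= => /andP[s2 s1] Is.
  case: ifPn => // s3; have -> : t = 2^-1 by apply/le_anti/andP.
  rewrite /a /b /= divff ?pnatr_eq0// subrr.
  by have [_ ->] := He s Is; have [->] := Ke s Is.
have half : (1 <= 2^-1 :> R) = false by apply/negbTE; lra.
exists L; split.
- rewrite D12; apply: (paste _ _ cHa cKb LH LK);
    apply: closed_rect; exact: itv_closed.
- rewrite D12 => _ [z [Dz|Dz] <-].
    by rewrite LH//; apply: HaA; exists z.
  by rewrite LK//; apply: KbA; exists z.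
- move=> t /I01 It; rewrite /L /path_concat /a /b /=; case: ifPn => t2.
    by apply: Hf; apply/I01; lra.
  by apply: Kg; apply/I01; lra.
- move=> s /[dup] Is /I01 s01; rewrite /L /a /b /path_concat /=.
  rewrite invr_ge0 ler0n half mulr0 (_ : 2 * 1 - 1 = 1); last lra.
  by have [-> _] := He s Is; have [_ ->] := Ke s Is.
Qed.

Lemma path_cst A x : A x -> is_path A x x (cst_path x).
Proof.
move=> Ax; split => //; last by move=> _ [t _ <-].
by apply: continuous_subspaceT => t; exact: cvg_cst.
Qed.

Lemma path_rev A x y f : is_path A x y f -> is_path A y x (path_inverse f).
Proof.
move=> pf; have [cf fA f0 f1] := pf.
have := @path_reparam A x y f (fun t => 1 - t) pf; rewrite subr0 subrr f0 f1.
apply; first by move=> t; apply: cvgB; [exact: cvg_cst|exact: cvg_id].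
by move=> _ [t /I01 t01 <-]; apply/I01; lra.
Qed.

Lemma path_cat A x y z f g :
  is_path A x y f -> is_path A y z g -> is_path A x z (path_concat f g).
Proof.
move=> pf pg; have [cf fA f0 f1] := pf; have [cg gA g0 g1] := pg.
have half : (1 <= 2^-1 :> R) = false by apply/negbTE; lra.
have IU : I = `[0, 2^-1] `|` `[2^-1, 1].
  apply/seteqP; split=> [s /I01|s]; rewrite /= !in_itv /=; last by case=> ?; lra.
  by move=> s01; have [|] := leP s 2^-1; [left|right]; lra.
have aI : (fun t : R => 2 * t) @` `[0, 2^-1] `<=` I.
  by move=> _ [t + <-]; rewrite /= !in_itv/=; lra.
have bI : (fun t : R => 2 * t - 1) @` `[2^-1, 1] `<=` I.
  by move=> _ [t + <-]; rewrite /= !in_itv/=; lra.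
split.
- rewrite IU; apply: (@paste _ _ _ _ (f \o (fun t => 2 * t)) (g \o (fun t => 2 * t - 1))).
  + exact: itv_closed.
  + exact: itv_closed.
  + apply: (within_comp cf) aI; apply: continuous_subspaceT => t.
    by apply: cvgM; [exact: cvg_cst|exact: cvg_id].
  + apply: (within_comp cg) bI; apply: continuous_subspaceT => t.
    apply: cvgB; last exact: cvg_cst.
    by apply: cvgM; [exact: cvg_cst|exact: cvg_id].
  + by move=> t; rewrite /= in_itv /= /path_concat => /andP[_ ->].
  + move=> t; rewrite /= in_itv /= /path_concat => /andP[t2 _].
    case: ifPn => // t3; have -> : t = 2^-1 by apply/le_anti/andP.
    by rewrite divff ?pnatr_eq0// subrr f1 g0.
- move=> _ [t /I01 t01 <-]; rewrite /path_concat; case: ifPn => t2.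
    by apply: fA; exists (2 * t) => //; apply/I01; lra.
  by apply: gA; exists (2 * t - 1) => //; apply/I01; lra.
- by rewrite /path_concat invr_ge0 ler0n mulr0.
- by rewrite /path_concat half (_ : 2 * 1 - 1 = 1); last lra.
Qed.

Lemma cat_pathA A w x y z f g h :
  is_path A w x f -> is_path A x y g -> is_path A y z h ->
  homotopic A (path_concat f (path_concat g h)) (path_concat (path_concat f g) h).
Proof.
move=> pf pg ph.
pose phi (t : R) := Num.min (2 * t) (Num.min (t + 4^-1) (2^-1 * (t + 1))).
have phiE t : phi t = if t <= 4^-1 then 2 * t else
    if t <= 2^-1 then t + 4^-1 else 2^-1 * (t + 1).
  rewrite /phi; case: (leP (t + 4^-1) (2^-1 * (t + 1))) => h1.
    by case: (leP (2 * t) (t + 4^-1)) => h2; do ![case: ifPn => ?]; lra.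
  by case: (leP (2 * t) (2^-1 * (t + 1))) => h2; do ![case: ifPn => ?]; lra.
have pfgh := path_cat pf (path_cat pg ph).
have cphi : continuous phi.
  move=> t; apply: continuous_min.
    by apply: cvgM; [exact: cvg_cst|exact: cvg_id].
  apply: continuous_min; first by apply: cvgD; [exact: cvg_id|exact: cvg_cst].
  apply: cvgM; first exact: cvg_cst.
  by apply: cvgD; [exact: cvg_id|exact: cvg_cst].
have := @homotopic_reparam A w z _ id phi pfgh.
have -> : path_concat f (path_concat g h) \o phi = path_concat (path_concat f g) h.
  apply/funext => t; rewrite /= phiE.
  case: (leP t 4^-1) => h1; last case: (leP t 2^-1) => h2; rewrite /path_concat;
    by do ![case: ifPn => ?]; try (congr (_ _); lra); exfalso; lra.
apply=> //; first by move=> ?; exact: cvg_id.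
- by move=> _ [t It <-].
- move=> _ [t /I01 t01 <-]; apply/I01; rewrite phiE.
  by do ![case: ifPn => ?]; lra.
- by rewrite phiE; do ![case: ifPn => ?]; lra.
- by rewrite phiE; do ![case: ifPn => ?]; lra.
Qed.

Lemma cat_cst_path A x y f : is_path A x y f ->
  homotopic A (path_concat (cst_path x) f) f.
Proof.
move=> pf; have [_ _ f0 _] := pf.
pose phi (t : R) := Num.max 0 (2 * t - 1).
have cphi : continuous phi.
  move=> t; apply: (@continuous_max R R (fun=> 0) (fun t => 2 * t - 1) t); first exact: cvg_cst.
  apply: cvgB; last exact: cvg_cst.
  by apply: cvgM; [exact: cvg_cst|exact: cvg_id].
have := @homotopic_reparam A x y _ phi id pf cphi.
have -> : f \o phi = path_concat (cst_path x) f.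
  apply/funext => t; rewrite /phi /path_concat /cst_path -f0 /= maxEle.
  by do ![case: ifPn => ?]; try (congr (_ _); lra); exfalso; lra.
apply=> //; first by move=> ?; exact: cvg_id.
- move=> _ [t /I01 t01 <-]; apply/I01; rewrite /phi !maxEle.
  by do ![case: ifPn => ?]; lra.
- by move=> _ [t It <-].
- by rewrite /phi !maxEle; do ![case: ifPn => ?]; lra.
- by rewrite /phi !maxEle; do ![case: ifPn => ?]; lra.
Qed.

Lemma cat_path_cst A x y f : is_path A x y f ->
  homotopic A (path_concat f (cst_path y)) f.
Proof.
move=> pf; have [_ _ _ f1] := pf.
pose phi (t : R) := Num.min (2 * t) 1.
have cphi : continuous phi.
  move=> t; apply: (@continuous_min R R (fun t => 2 * t) (fun=> 1) t); last exact: cvg_cst.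
  by apply: cvgM; [exact: cvg_cst|exact: cvg_id].
have := @homotopic_reparam A x y _ phi id pf cphi.
have -> : f \o phi = path_concat f (cst_path y).
  apply/funext => t; rewrite /phi /path_concat /cst_path -f1 /= minEle.
  by do ![case: ifPn => ?]; try (congr (_ _); lra); exfalso; lra.
apply=> //; first by move=> ?; exact: cvg_id.
- move=> _ [t /I01 t01 <-]; apply/I01; rewrite /phi !minEle.
  by do ![case: ifPn => ?]; lra.
- by move=> _ [t It <-].
- by rewrite /phi !minEle; do ![case: ifPn => ?]; lra.
- by rewrite /phi !minEle; do ![case: ifPn => ?]; lra.
Qed.

Lemma cat_rev_path A x y f : is_path A x y f ->
  homotopic A (path_concat (path_inverse f) f) (cst_path y).
Proof.
move=> pf; have [_ _ _ f1] := pf.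
pose phi (t : R) := `|2 * t - 1|.
have cphi : continuous phi.
  move=> t; apply: cvg_norm; apply: cvgB; last exact: cvg_cst.
  by apply: cvgM; [exact: cvg_cst|exact: cvg_id].
have := @homotopic_reparam A x y _ phi (fun=> 1) pf cphi.
have -> : f \o phi = path_concat (path_inverse f) f.
  apply/funext => t; rewrite /phi /path_concat /path_inverse /=; case: ifPn => t2.
    by rewrite ler0_norm; [congr f; lra|lra].
  by rewrite ger0_norm //; lra.
rewrite -[_ \o (fun=> 1)]/(fun=> f 1) f1; apply=> //.
- by move=> ?; exact: cvg_cst.
- by move=> _ [t /I01 t01 <-]; apply/I01; rewrite /phi; rewrite normr_ge0 ler_norml; lra.
- by move=> _ [t It <-]; exact: I_1.
- by rewrite /phi mulr0 sub0r normrN normr1.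
- by rewrite /phi ger0_norm; lra.
Qed.

Lemma rev_pathK f : path_inverse (path_inverse f) = f.
Proof. by apply/funext => t; rewrite /path_inverse; congr f; lra. Qed.

Lemma homotopic_rev A f g : homotopic A f g ->
  homotopic A (path_inverse f) (path_inverse g).
Proof.
move=> [H [cH HA Hfg He]].
have c : continuous (fun z : R * R => (1 - z.1, z.2)).
  apply: continuous_comb => z; last exact: cvg_snd.
  by apply: cvgB; [exact: cvg_cst|exact: cvg_fst].
have [||cK KA] := @homotopic_sub H (fun z => (1 - z.1, z.2)) (I `*` I) A cH HA.
- exact: continuous_subspaceT.
- by move=> _ [[t s] [/I01 /= It /I01 /= Is] <-]; split; apply/I01 => //=; lra.
exists (H \o (fun z => (1 - z.1, z.2))); split => //= [t /I01 t01|s Is].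
  by apply: Hfg; apply/I01; lra.
by rewrite /path_inverse subr0 subrr; have [] := He s Is.
Qed.

End Paths.

Section FundamentalGroup.
Context {R : realType} {M : topologicalType}.
Local Open Scope quotient_scope.

Definition loop (A : set M) (x : A) :=
  {f : R -> M | is_path A (\val x) (\val x) f}.

HB.instance Definition _ (A : set M) (x : A) := gen_eqMixin (loop x).
HB.instance Definition _ (A : set M) (x : A) := gen_choiceMixin (loop x).

Section Fixed.
Variables (A : set M) (x : A).
Implicit Types l : loop x.

Definition loop_homotopic l1 l2 := `[< homotopic A (sval l1) (sval l2) >].

Lemma loop_homotopic_equiv : equiv_class_of loop_homotopic.
Proof.
split=> [[f pf]|[f pf] [g pg]|[g pg] [f pf] [h ph]].
- by apply/asboolP; exact: homotopic_refl pf.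
- by apply/asboolP/asboolP; exact: homotopic_sym.
- by move=> /asboolP fg /asboolP gh; apply/asboolP; exact: homotopic_trans gh.
Qed.

Canonical loop_homotopic_equivRel := EquivRelPack loop_homotopic_equiv.

Definition pi1 := {eq_quot loop_homotopic}.
HB.instance Definition _ := Choice.on pi1.

Definition loop_mul l1 l2 : loop x :=
  exist _ (path_concat (sval l1) (sval l2)) (path_cat (svalP l1) (svalP l2)).
Definition loop_inv l : loop x :=
  exist _ (path_inverse (sval l)) (path_rev (svalP l)).
Definition loop_one : loop x :=
  exist _ (cst_path (\val x)) (path_cst (set_valP x)).

Definition pi1_mul (a b : pi1) : pi1 := \pi_pi1 (loop_mul (repr a) (repr b)).
Definition pi1_inv (a : pi1) : pi1 := \pi_pi1 (loop_inv (repr a)).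
Definition pi1_one : pi1 := \pi_pi1 loop_one.

Lemma pi1P l1 l2 :
  (\pi_pi1 l1 = \pi_pi1 l2) <-> homotopic A (sval l1) (sval l2).
Proof. by split=> [/eqmodP/asboolP//|h]; apply/eqmodP/asboolP. Qed.

Lemma repr_homotopic l : homotopic A (sval (repr (\pi_pi1 l : pi1))) (sval l).
Proof. by apply/pi1P; rewrite reprK. Qed.

Lemma pi1_pi_mul l1 l2 : pi1_mul (\pi_pi1 l1) (\pi_pi1 l2) = \pi_pi1 (loop_mul l1 l2).
Proof.
apply/pi1P; apply: homotopic_cat; [|exact: repr_homotopic..].
have [_ _ _ ->] := svalP (repr (\pi_pi1 l1 : pi1)).
by have [_ _ -> _] := svalP (repr (\pi_pi1 l2 : pi1)).
Qed.

Lemma pi1_pi_inv l : pi1_inv (\pi_pi1 l) = \pi_pi1 (loop_inv l).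
Proof. by apply/pi1P; apply: homotopic_rev; exact: repr_homotopic. Qed.

Lemma pi1_ex a : exists l, a = \pi_pi1 l.
Proof. by exists (repr a); rewrite reprK. Qed.

Lemma pi1_mulA : associative pi1_mul.
Proof.
move=> a b c.
have [[f pf] ->] := pi1_ex a; have [[g pg] ->] := pi1_ex b.
have [[h ph] ->] := pi1_ex c; rewrite !pi1_pi_mul; apply/pi1P.
exact: (cat_pathA pf pg ph).
Qed.

Lemma pi1_mul1 : left_id pi1_one pi1_mul.
Proof.
move=> a; have [[f pf] ->] := pi1_ex a; rewrite pi1_pi_mul; apply/pi1P.
exact: (cat_cst_path pf).
Qed.

Lemma pi1_1mul : right_id pi1_one pi1_mul.
Proof.
move=> a; have [[f pf] ->] := pi1_ex a; rewrite pi1_pi_mul; apply/pi1P.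
exact: (cat_path_cst pf).
Qed.

Lemma pi1_mulV : left_inverse pi1_one pi1_inv pi1_mul.
Proof.
move=> a; have [[f pf] ->] := pi1_ex a; rewrite pi1_pi_inv pi1_pi_mul; apply/pi1P.
exact: (cat_rev_path pf).
Qed.

Lemma pi1_Vmul : right_inverse pi1_one pi1_inv pi1_mul.
Proof.
move=> a; have [[f pf] ->] := pi1_ex a; rewrite pi1_pi_inv pi1_pi_mul; apply/pi1P => /=.
rewrite -[X in path_concat X]rev_pathK.
exact: (cat_rev_path (path_rev pf)).
Qed.

HB.instance Definition _ := isGroup.Build pi1
  pi1_mulA pi1_mul1 pi1_1mul pi1_mulV pi1_Vmul.

(* The class of f, or 1 if f is not a loop of A at x. *)
Definition pi1_class (f : R -> M) : pi1 :=
  if pselect (is_path A (\val x) (\val x) f) is left pf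
  then \pi_pi1 (exist _ f pf) else 1%g.

End Fixed.
End FundamentalGroup.

Arguments loop R {M A} x.
Arguments pi1 R {M A} x.
Arguments pi1_class {R M A} x f.

Section GraphOfGroups.

(* A geometric edge j carries the two mutually inverse oriented edges
   (j, false) and (j, true); [endpoint j b] is the origin of (j, b) and
   [edge_mono j b] the monomorphism from the edge group to its vertex group. *)
Record graph_of_groups := GraphOfGroups {
  vertex : finType;
  geom_edge : finType;
  endpoint : geom_edge -> bool -> vertex;
  vgroup : vertex -> groupType;
  egroup : geom_edge -> groupType;
  edge_mono : forall j b, {multiplicative egroup j -> vgroup (endpoint j b)};
  edge_mono_inj : forall j b, injective (edge_mono j b) }.

Variable X : graph_of_groups.
Local Notation V := (vertex X).
Local Open Scope group_scope.

Definition edge : Type := geom_edge X * bool.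
Definition bar (e : edge) : edge := (e.1, ~~ e.2).
Definition orig (e : edge) : V := endpoint e.1 e.2.
Definition extr (e : edge) : V := endpoint e.1 (~~ e.2).
Definition phim (e : edge) : egroup e.1 -> vgroup (orig e) := edge_mono e.1 e.2.
Definition phip (e : edge) : egroup e.1 -> vgroup (extr e) :=
  edge_mono e.1 (~~ e.2).

(* Edge paths of X from u to v whose i-th edge e_i carries a datum in D e_i. *)
Inductive epath (D : edge -> Type) : V -> V -> Type :=
| enil v : epath D v v
| econs e v of D e & epath D (extr e) v : epath D (orig e) v.

Fixpoint elength D u v (p : epath D u v) : nat :=
  if p is econs _ _ _ p' then (elength p').+1 else 0%N.

Fixpoint ecat D u v w (p : epath D u v) : epath D v w -> epath D u w :=
  match p with
  | enil _ => id
  | econs _ _ d p' => fun q => econs d (ecat p' q)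
  end.

Definition first_edge D u v (p : epath D u v) : option edge :=
  if p is econs e _ _ _ then Some e else None.

Fixpoint edges_in (T : set (geom_edge X)) D u v (p : epath D u v) : Prop :=
  if p is econs e _ _ p' then T e.1 /\ edges_in T p' else True.

Fixpoint backtrack_free D u v (p : epath D u v) : Prop :=
  if p is econs e _ _ p'
  then first_edge p' <> Some (bar e) /\ backtrack_free p' else True.

(* A subgraph without nontrivial closed path free of backtracking is a forest. *)
Definition maximal_tree (T : set (geom_edge X)) : Prop :=
  (forall u v, exists p : epath (fun=> unit) u v, edges_in T p) /\
  (forall v (p : epath (fun=> unit) v v),
     edges_in T p -> backtrack_free p -> elength p = 0%N).

(* pi_1(G, X) relative to T, by generators and relations: [inl (Tagged _ g)]
   stands for g in a vertex group and [inr e] for t_e. *)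
Definition gen_word : Type := seq ({v : V & vgroup v} + edge).
Definition vgen (v : V) (g : vgroup v) : {v : V & vgroup v} + edge :=
  inl (Tagged (@vgroup X) g).
Definition tgen (e : edge) : {v : V & vgroup v} + edge := inr e.

Section Presentation.
Variable T : set (geom_edge X).

(* The last rule says that t_e = 1 for e in T; the rule on [bar] makes
   t_(bar e) the inverse of t_e. *)
Inductive gen_rel : gen_word -> gen_word -> Prop :=
| gen_rel_refl s : gen_rel s s
| gen_rel_sym s1 s2 : gen_rel s1 s2 -> gen_rel s2 s1
| gen_rel_trans s1 s2 s3 : gen_rel s1 s2 -> gen_rel s2 s3 -> gen_rel s1 s3
| gen_rel_cat s1 s2 s3 s4 :
    gen_rel s1 s2 -> gen_rel s3 s4 -> gen_rel (s1 ++ s3) (s2 ++ s4)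
| gen_rel_one v : gen_rel [:: vgen (1 : vgroup v)] [::]
| gen_rel_mul v (g h : vgroup v) :
    gen_rel [:: vgen g; vgen h] [:: vgen (g * h)]
| gen_rel_bar e : gen_rel [:: tgen e; tgen (bar e)] [::]
| gen_rel_edge e (c : egroup e.1) :
    gen_rel [:: tgen e; vgen (phip c); tgen (bar e)] [:: vgen (phim c)]
| gen_rel_tree e : T e.1 -> gen_rel [:: tgen e] [::].

HB.instance Definition _ := gen_eqMixin gen_word.
HB.instance Definition _ := gen_choiceMixin gen_word.

Definition gen_relb (s1 s2 : gen_word) := `[< gen_rel s1 s2 >].

Lemma gen_rel_equiv : equiv_class_of gen_relb.
Proof.
split=> [s|s1 s2|s1 s2 s3]; first exact/asboolP/gen_rel_refl.
- by apply/asboolP/asboolP; exact: gen_rel_sym.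
- by move=> /asboolP h1 /asboolP h2; exact/asboolP/(gen_rel_trans h1).
Qed.

Canonical gen_rel_equivRel := EquivRelPack gen_rel_equiv.

Local Open Scope quotient_scope.

Definition pi1_gog := {eq_quot gen_relb}.
HB.instance Definition _ := Choice.on pi1_gog.

Definition inv_gen (x : {v : V & vgroup v} + edge) : {v : V & vgroup v} + edge :=
  match x with
  | inl g => vgen (tagged g)^-1
  | inr e => tgen (bar e)
  end.

Definition gen_inv (s : gen_word) : gen_word :=
  rev (map inv_gen s).

Definition gog_mul (a b : pi1_gog) : pi1_gog := \pi_pi1_gog (repr a ++ repr b).
Definition gog_inv (a : pi1_gog) : pi1_gog := \pi_pi1_gog (gen_inv (repr a)).
Definition gog_one : pi1_gog := \pi_pi1_gog ([::] : gen_word).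

Lemma gogP s1 s2 : (\pi_pi1_gog s1 = \pi_pi1_gog s2) <-> gen_rel s1 s2.
Proof. by split=> [/eqmodP/asboolP//|h]; apply/eqmodP/asboolP. Qed.

Lemma gog_ex (a : pi1_gog) : exists s, a = \pi_pi1_gog s.
Proof. by exists (repr a); rewrite reprK. Qed.

Lemma gog_pi_mul s1 s2 :
  gog_mul (\pi_pi1_gog s1) (\pi_pi1_gog s2) = \pi_pi1_gog (s1 ++ s2).
Proof. by apply/gogP; apply: gen_rel_cat; apply/gogP; rewrite reprK. Qed.

Lemma gog_mulA : associative gog_mul.
Proof.
move=> a b c; have [s1 ->] := gog_ex a; have [s2 ->] := gog_ex b.
by have [s3 ->] := gog_ex c; rewrite !gog_pi_mul catA.
Qed.

Lemma gog_mul1 : left_id gog_one gog_mul.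
Proof. by move=> a; have [s ->] := gog_ex a; rewrite gog_pi_mul. Qed.

Lemma gog_1mul : right_id gog_one gog_mul.
Proof. by move=> a; have [s ->] := gog_ex a; rewrite gog_pi_mul cats0. Qed.

Lemma barK : involutive bar.
Proof. by case=> j b; rewrite /bar /= negbK. Qed.

Lemma gen_relV v (g h : vgroup v) : g * h = 1 -> gen_rel [:: vgen g; vgen h] [::].
Proof.
move=> gh; apply: gen_rel_trans (gen_rel_mul g h) _; rewrite gh.
exact: gen_rel_one.
Qed.

Lemma gen_mulV s : gen_rel (gen_inv s ++ s) [::] /\ gen_rel (s ++ gen_inv s) [::].
Proof.
suff H t : gen_rel (gen_inv t ++ t) [::].
  have gen_invK t : gen_inv (gen_inv t) = t.
    rewrite /gen_inv map_rev revK -map_comp -[RHS]map_id; apply: eq_map.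
    by case=> [[v g]|e] /=; rewrite ?barK // /vgen /= invgK.
  by split=> //; rewrite -[X in X ++ _]gen_invK.
elim: t => [|x t IH]; first exact: gen_rel_refl.
rewrite /gen_inv /= rev_cons -/(gen_inv t) cat_rcons -[x :: t]cat1s.
set y := (X in _ ++ X :: _).
rewrite -[y :: _]/([:: y; x] ++ t).
suff yx : gen_rel [:: y; x] [::].
  apply: gen_rel_trans IH; apply: gen_rel_cat; first exact: gen_rel_refl.
  by rewrite -[X in gen_rel _ X]cat0s; apply: gen_rel_cat => //; exact: gen_rel_refl.
rewrite /y; case: x {y} => [[v g]|e]; first by apply: gen_relV; rewrite /= mulVg.
by rewrite -[X in [:: _; inr X]]barK; exact: gen_rel_bar.
Qed.

Lemma gog_mulV : left_inverse gog_one gog_inv gog_mul.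
Proof.
move=> a; rewrite /gog_inv -{2}[a]reprK gog_pi_mul.
by apply/gogP; have [] := gen_mulV (repr a).
Qed.

Lemma gog_Vmul : right_inverse gog_one gog_inv gog_mul.
Proof.
move=> a; rewrite /gog_inv -{1}[a]reprK gog_pi_mul.
by apply/gogP; have [] := gen_mulV (repr a).
Qed.

HB.instance Definition _ := isGroup.Build pi1_gog
  gog_mulA gog_mul1 gog_1mul gog_mulV gog_Vmul.

Definition gog_vertex v (g : vgroup v) : pi1_gog := \pi_pi1_gog [:: vgen g].
Definition gog_edge (e : edge) : pi1_gog := \pi_pi1_gog [:: tgen e].

End Presentation.

Definition letters := epath (fun e => vgroup (orig e)).
Definition echain := epath (fun e => egroup e.1).

(* (mu_1, e_1, ..., mu_n, e_n) is [letters]; mu_{n+1} is [last_elt]. *)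
Record word := Word {
  base : V;
  lets : letters base base;
  last_elt : vgroup base }.

Definition word_length (w : word) : nat := elength (lets w).

Section Label.
Variable T : set (geom_edge X).

Fixpoint letters_label u v (l : letters u v)
    : pi1_gog T :=
  match l with
  | enil _ => 1
  | econs e _ mu l' => gog_vertex T mu * gog_edge T e * letters_label l'
  end.

Definition label (w : word) : pi1_gog T :=
  letters_label (lets w) * gog_vertex T (last_elt w).

(* If the first edge e' of l satisfies e = bar e', then the vertex element
   preceding e' is not in S. *)
Definition first_avoids (e : edge) u v (l : letters u v) :
    set (vgroup u) -> Prop :=
  match l with
  | enil _ => fun=> True
  | econs e' _ mu _ => fun S => e = bar e' -> ~ S mu
  end.

Fixpoint letters_reduced u v (l : letters u v) : Prop :=
  if l is econs e _ _ l' then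
    first_avoids e l' (range (@phip e)) /\ letters_reduced l'
  else True.

Definition reduced (w : word) : Prop :=
  if word_length w == 0%N then label w <> 1 else letters_reduced (lets w).

(* [cyclic_conj_rot] moves the initial segment (mu_1, e_1, ..., e_(i-1)),
   1 < i <= n + 1, to the end; [cyclic_conj_refl] is the case i = 1, and the
   only one if n = 0. *)
Inductive cyclic_conj : word -> word -> Prop :=
| cyclic_conj_refl w : cyclic_conj w w
| cyclic_conj_rot e v (mu : vgroup (orig e)) (l1 : letters (extr e) v)
    (l2 : letters v (orig e)) (m : vgroup (orig e)) :
    cyclic_conj (Word (ecat (econs mu l1) l2) m)
                (Word (ecat l2 (econs (D := fun e => vgroup (orig e)) (m * mu) l1)) 1).

Definition cyclically_reduced (w : word) : Prop :=
  (forall w', cyclic_conj w w' -> reduced w') /\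
  ((0 < word_length w)%N -> last_elt w = 1).

End Label.

Definition conj_in (G : groupType) (x y : G) : Prop := exists z, y = x ^ z.

(* g ~ c_1^- , c_i^+ ~ c_{i+1}^- and c_p^+ ~ g'. *)
Fixpoint chain_conj u v (c : echain u v) :
    vgroup u -> vgroup v -> Prop :=
  match c with
  | enil _ => fun g g' => conj_in g g'
  | econs _ _ c1 c' => fun g g' =>
      conj_in g (phim c1) /\ chain_conj c' (phip c1) g'
  end.

(* c_n^+, or a if n = 0. *)
Fixpoint chain_last u v (c : echain u v) :
    vgroup u -> vgroup v :=
  match c with
  | enil _ => id
  | econs _ _ c1 c' => fun=> chain_last c' (phip c1)
  end.

(* l, l' and c follow the same path (e_1, ..., e_n), and, with c_0^+ := a,
   mu_i = c_{i-1}^+ mu'_i (c_i^-)^-1 for i = 1, ..., n. *)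
Inductive twisted : forall u v,
  vgroup u -> echain u v -> letters u v -> letters u v -> Prop :=
| twisted_nil v (a : vgroup v) : twisted a (enil _ v) (enil _ v) (enil _ v)
| twisted_cons e v (a mu mu' : vgroup (orig e)) (c1 : egroup e.1)
    (c : echain (extr e) v) (l l' : letters (extr e) v) :
    mu = a * mu' * (phim c1)^-1 -> twisted (phip c1) c l l' ->
    twisted a (econs (D := fun e => egroup e.1) c1 c)
      (econs (D := fun e => vgroup (orig e)) mu l)
      (econs (D := fun e => vgroup (orig e)) mu' l').

End GraphOfGroups.

(* Everything is in the topological category, with bicollared (hence locally
   flat) surfaces; in dimension 3 this agrees with the smooth and PL ones.
   The norm of 'rV[R]_n being the sup norm, spheres and disks are defined with
   [sqnorm]. *)
Section Topology.
Variable R : realType.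
Local Notation I := (`[0, 1]%classic : set R).
Local Notation J := (`[-1, 1]%classic : set R).
Local Notation Jo := (`]-1, 1[%classic : set R).

Definition homeo_on (X Y : topologicalType) (A : set X) (B : set Y) (f : X -> Y) :=
  [/\ {within A, continuous f}, f @` A = B &
      exists g : Y -> X, {within B, continuous g} /\ {in A, cancel f g}].

Definition embedding_on (X Y : topologicalType) (A : set X) (f : X -> Y) :=
  homeo_on A (f @` A) f.

Definition homeomorphic (X Y : topologicalType) (A : set X) (B : set Y) :=
  exists f, homeo_on A B f.

Definition sqnorm n (x : 'rV[R]_n) : R := \sum_i x 0 i ^+ 2.
Definition sphere n : set 'rV[R]_n.+1 := [set x | sqnorm x = 1].
Definition disk n : set 'rV[R]_n := [set x | sqnorm x <= 1].
Definition torus : set ('rV[R]_2 * 'rV[R]_2) := @sphere 1 `*` @sphere 1.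

Definition rotation (theta : R) (x : 'rV[R]_2) : 'rV[R]_2 :=
  \row_i (if i == 0 then cos theta * x 0 0 - sin theta * x 0 1
          else sin theta * x 0 0 + cos theta * x 0 1).

Fixpoint of_class (k : nat) (O : set 'rV[R]_3) (f : 'rV[R]_3 -> R^o) : Prop :=
  if k is k'.+1 then
    (forall x, O x -> differentiable f x) /\
    forall i : 'I_3, of_class k' O (fun x => 'D_(delta_mx 0 i) f x)
  else forall x, O x -> {for x, continuous f}.

Definition smooth_on (O : set 'rV[R]_3) (h : 'rV[R]_3 -> 'rV[R]_3) :=
  forall k i, of_class k O (fun x => h x 0 i).

Section Manifold.
Variable M : topologicalType.

Definition is_chart (c : set M * (M -> 'rV[R]_3)) :=
  [/\ open c.1, open (c.2 @` c.1) & embedding_on c.1 c.2].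

(* The atlas only expresses orientability. *)
Definition oriented_atlas (At : set (set M * (M -> 'rV[R]_3))) :=
  [/\ forall c, At c -> is_chart c,
      \bigcup_(c in At) c.1 = setT &
      forall c c', At c -> At c' -> exists h : 'rV[R]_3 -> 'rV[R]_3,
        [/\ forall x, (c.1 `&` c'.1) x -> h (c.2 x) = c'.2 x,
            smooth_on (c.2 @` (c.1 `&` c'.1)) h &
            forall p, (c.2 @` (c.1 `&` c'.1)) p -> 0 < \det ('J h p)]].

(* Second countability follows from compactness. *)
Definition closed_oriented_3manifold :=
  [/\ hausdorff_space M, compact [set: M], connected [set: M],
      [set: M] !=set0 & exists At, oriented_atlas At].

(* The inclusion of S in P is injective on fundamental groups, for every base
   point of S. *)
Definition pi1_injective (S P : set M) := forall (x : M) (f : R -> M),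
  is_path S x x f -> homotopic P f (cst_path x) -> homotopic S f (cst_path x).

Definition two_sided (S : set M) := exists c : M * R -> M,
  embedding_on (S `*` J) c /\ forall x, S x -> c (x, 0) = x.

Definition closed_surface (S : set M) :=
  [/\ compact S, connected S, S !=set0 &
      forall x, S x -> exists U : set M,
        [/\ open U, U x & homeomorphic (S `&` U) [set: 'rV[R]_2]]].

Definition irreducible := forall S : set M,
  homeomorphic S (@sphere 2) -> two_sided S ->
  exists b : 'rV[R]_3 -> M, embedding_on (@disk 3) b /\ b @` (@sphere 2) = S.

Definition incompressible_surface (S : set M) :=
  [/\ closed_surface S, two_sided S, ~ homeomorphic S (@sphere 2) &
      pi1_injective S setT].

Definition closed_haken :=
  [/\ closed_oriented_3manifold, irreducible &
      exists S, incompressible_surface S].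

(* The fiber through z of the fibered solid torus of type (p, q): an orbit of
   the circle action of weights (p, q) on D^2 x S^1. *)
Definition model_fiber (p q : nat) (z : 'rV[R]_2 * 'rV[R]_2) :=
  range (fun theta : R => (rotation (p%:R * theta) z.1, rotation (q%:R * theta) z.2)).

Definition seifert_fibered (P : set M) := exists F : set (set M),
  [/\ \bigcup_(C in F) C = P, trivIset F id &
      forall C, F C -> exists p q (h : 'rV[R]_2 * 'rV[R]_2 -> M),
        [/\ (0 < q)%N /\ coprime p q,
            embedding_on (@disk 2 `*` @sphere 1) h,
            h @` (@disk 2 `*` @sphere 1) `<=` P,
            exists U : set M,
              [/\ open U, C `<=` U & U `&` P `<=` h @` (@disk 2 `*` @sphere 1)] &
            forall z, (@disk 2 `*` @sphere 1) z -> F (h @` model_fiber p q z)]].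

(* P is a 3-manifold with boundary P \ P^o. *)
Definition boundary_parallel (S P : set M) :=
  exists g : ('rV[R]_2 * 'rV[R]_2) * R -> M,
    [/\ embedding_on (torus `*` I) g, g @` (torus `*` I) `<=` P,
        g @` (torus `*` [set 0]) = S & g @` (torus `*` [set 1]) `<=` P `\` interior P].

Definition atoroidal (P : set M) :=
  forall tau : ('rV[R]_2 * 'rV[R]_2) * R -> M,
    embedding_on (torus `*` J) tau ->
    tau @` (torus `*` J) `<=` interior P ->
    pi1_injective (tau @` (torus `*` [set 0])) P ->
    boundary_parallel (tau @` (torus `*` [set 0])) P.

(* tau j parametrizes a closed bicollar of the torus T_j = tau j (torus x 0);
   the open regular neighbourhood removed when cutting is
   tau j (torus x ]-1, 1[), with boundary tori T_j^- and T_j^+ at -1 and 1. *)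
Record torus_system := TorusSystem {
  ntori : nat;
  tau : 'I_ntori -> ('rV[R]_2 * 'rV[R]_2) * R -> M;
  tau_embedding : forall j, embedding_on (torus `*` J) (tau j);
  tau_disjoint : trivIset setT (fun j => tau j @` (torus `*` J));
  tau_essential : forall j, pi1_injective (tau j @` (torus `*` [set 0])) setT }.

Section TorusSystem.
Variable W : torus_system.

Definition sgn (b : bool) : R := if b then 1 else -1.

Definition core (j : 'I_(ntori W)) : set M := tau j @` (torus `*` [set 0]).
Definition side (j : 'I_(ntori W)) (b : bool) : set M :=
  tau j @` (torus `*` [set sgn b]).
Definition union_tori : set M := \bigcup_j core j.
Definition cut_manifold : set M :=
  ~` \bigcup_(j in [set: 'I_(ntori W)]) tau j @` (torus `*` Jo).
Definition pieces : set (set M) :=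
  [set connected_component cut_manifold x | x in cut_manifold].

Definition splitting :=
  forall P, pieces P -> seifert_fibered P \/ atoroidal P.

End TorusSystem.

Definition ambient_isotopy (H : R -> M -> M) :=
  [/\ {within I `*` setT, continuous (fun z : R * M => H z.1 z.2)},
      H 0 = id & forall t, I t -> homeo_on setT setT (H t)].

(* Minimality is for the relation: W' is ambient isotopic to a subset of W. *)
Definition jsj (W : torus_system) := splitting W /\
  forall W' H, splitting W' -> ambient_isotopy H ->
    H 1 @` union_tori W' `<=` union_tori W -> H 1 @` union_tori W' = union_tori W.

(* The graph of groups of W, with the choices it depends on: T_j^b lies in the
   piece [end_of j b]; ebase j and ypt j are the base point of T_j and its
   coordinates on the torus; arc j b joins in the piece its base point to the
   copy of ebase j in T_j^b; incl_mono j b is induced by pushing a loop of T_j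
   to T_j^b and conjugating by arc j b. *)
Record jsj_graph (W : torus_system) := JSJGraph {
  npieces : nat;
  piece : 'I_npieces -> set M;
  piece_inj : injective piece;
  piece_range : range piece = pieces W;
  end_of : 'I_(ntori W) -> bool -> 'I_npieces;
  end_ofP : forall j b, side j b `<=` piece (end_of j b);
  vbase : forall i, piece i;
  ypt : 'I_(ntori W) -> 'rV[R]_2 * 'rV[R]_2;
  yptP : forall j, torus (ypt j);
  ebase : forall j : 'I_(ntori W), core j;
  ebaseP : forall j, \val (ebase j) = tau j (ypt j, 0);
  arc : 'I_(ntori W) -> bool -> R -> M;
  arcP : forall j b, is_path (piece (end_of j b))
    (\val (vbase (end_of j b))) (tau j (ypt j, sgn b)) (arc j b);
  incl_mono : forall j b,
    {multiplicative pi1 R (ebase j) -> pi1 R (vbase (end_of j b))};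
  incl_mono_inj : forall j b, injective (incl_mono j b);
  incl_monoE : forall j b (d : R -> 'rV[R]_2 * 'rV[R]_2),
    is_path torus (ypt j) (ypt j) d ->
    incl_mono j b (pi1_class (ebase j) (fun t => tau j (d t, 0))) =
    pi1_class (vbase (end_of j b))
      (path_concat (path_concat (arc j b) (fun t => tau j (d t, sgn b)))
                (path_inverse (arc j b))) }.

Arguments piece {W} X i : rename.
Arguments vbase {W} X i : rename.
Arguments ebase {W} X j : rename.
Arguments ypt {W} X j : rename.
Arguments arc {W} X j b _ : rename.
Arguments end_of {W} X j b : rename.
Arguments incl_mono {W} X j b : rename.

Definition jsj_gog (W : torus_system) (X : jsj_graph W) : graph_of_groups :=
  @GraphOfGroups 'I_(npieces X) 'I_(ntori W) (end_of X)
    (fun i => pi1 R (vbase X i)) (fun j => pi1 R (ebase X j))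
    (incl_mono X) (@incl_mono_inj W X).

(* The van Kampen identification of pi_1(G, X) with pi_1(M, x0), for paths
   gamma i from x0 to the base points of the pieces. The loop of t_(j, b)
   goes through T_j from the side b to the opposite side. *)
Section Identification.
Variables (W : torus_system) (X : jsj_graph W) (T : set 'I_(ntori W)).

Definition crossing (j : 'I_(ntori W)) (b : bool) : R -> M :=
  fun t => tau j (ypt X j, (1 - t) * sgn b + t * sgn (~~ b)).

Definition identification (x0 : [set: M])
    (Phi : {multiplicative pi1_gog (X := jsj_gog X) T -> pi1 R x0}) :=
  bijective Phi /\
  exists gamma : 'I_(npieces X) -> R -> M,
    [/\ forall i, is_path setT (\val x0) (\val (vbase X i)) (gamma i),
        forall i f, is_path (piece X i) (\val (vbase X i)) (\val (vbase X i)) f ->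
          Phi (gog_vertex (X := jsj_gog X) T (v := i) (pi1_class (vbase X i) f)) =
          pi1_class x0 (path_concat (path_concat (gamma i) f) (path_inverse (gamma i))) &
        forall j b,
          Phi (gog_edge (X := jsj_gog X) T (j, b)) =
          pi1_class x0
            (path_concat (path_concat (gamma (end_of X j b)) (arc X j b))
              (path_concat (crossing j b)
                 (path_inverse (path_concat (gamma (end_of X j (~~ b)))
                                     (arc X j (~~ b))))))].

End Identification.
End Manifold.
End Topology.

(* Main.v *)
Require Import Defs.
From HB Require Import structures.
From mathcomp Require Import all_boot all_order all_algebra generic_quotient.
From mathcomp Require Import all_classical all_reals all_analysis.
From mathcomp Require Import zify.
Set Implicit Arguments.
Unset Strict Implicit.
Unset Printing Implicit Defensive.
Local Open Scope group_scope.

(* Embed every vertex group in the direct product G of all of them. The stable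
   letters then generate over G a multiple HNN extension H (the path group of a
   one-vertex graph), and once the vertices are linked by paths of the maximal
   tree, g in G(v) |-> P_v g P_v^-1 and t_e |-> P_orig(e) t_e P_extr(e)^-1 map
   pi_1(G, X) to H, where words carry no typing constraint. In H, the action of the
   generators on reduced words gives Britton's lemma, and with it that reduced
   words are unique up to twisting and shortest among the words with the same value.
   If z x z^-1 = y with x cyclically reduced and y not longer than x, then either
   the product pinches at an end of x, and z is shortened by rotating x (or
   by passing to the other end of an edge, when x has length 0), or z x z^-1 is
   longer than y, unless z lies in G. *)

Lemma multiplicative1 (G H : groupType) (f : {multiplicative G -> H}) : f 1 = 1.
Proof. by apply: (mulgI (f 1)); rewrite -gmulfM !mulg1. Qed.

Lemma multiplicativeV (G H : groupType) (f : {multiplicative G -> H}) :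
  {morph f : x / x^-1}.
Proof. by move=> x; apply: (mulgI (f x)); rewrite -gmulfM !mulgV multiplicative1. Qed.

(** * Reduced words in HNN extensions *)

(* [assoc e p q] is the relation [t_e p t_e^-1 = q]; a word
   [g_1 t_(e_1) ... g_n t_(e_n) m] is the pair of the list of the [(g_i, e_i)]
   and of [m]. *)
Section NormalForms.
Variables (G : groupType) (E : eqType) (opp : E -> E) (assoc : E -> G -> G -> Prop).
Hypothesis oppK : involutive opp.
Hypothesis assoc1 : forall e, assoc e 1 1.
Hypothesis assocM : forall e p q p' q',
  assoc e p q -> assoc e p' q' -> assoc e (p * p') (q * q').
Hypothesis assocV : forall e p q, assoc e p q -> assoc e p^-1 q^-1.
Hypothesis assoc_fun : forall e p q q', assoc e p q -> assoc e p q' -> q = q'.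
Hypothesis assoc_opp : forall e p q, assoc e p q -> assoc (opp e) q p.

Implicit Types (e f : E) (l : seq (G * E)) (r : seq (G * E) * G) (g m : G).

(** In [t_e g t_f] the two stable letters cancel and leave [q] in the base group. *)
Definition pinch e g f := e = opp f /\ exists q, assoc e g q.
(** Only the edge of [x] matters: the element between the two stable letters is [y.1]. Being a
    boolean relation, it makes reduced words the [sorted] lists and cyclically reduced ones the
    [cycle]s. *)
Definition nopinch (x y : G * E) : bool := `[< ~ pinch x.2 y.1 y.2 >].

(* A syntactic form of [(l, m) = a (l', m')]. *)
Fixpoint teq a l m l' m' : Prop :=
  match l, l' with
  | [::], [::] => m = a * m'
  | (g, e) :: k, (g', e') :: k' =>
      e = e' /\ exists p q, [/\ assoc e p q, g = a * g' * q^-1 & teq p k m k' m']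
  | _, _ => False
  end.

Definition lmulw g r :=
  if r.1 is (h, e) :: l then ((g * h, e) :: l, r.2) else ([::], g * r.2).

Definition push e r := ((1, e) :: r.1, r.2).

(** Left multiplication by [t_e], performed so as to keep words reduced. The element left by a pinch
    is picked by choice; [assoc_fun] makes it unique. *)
Definition tact e r :=
  if r.1 is (g, f) :: l then
    if pselect (pinch e g f) is left ex then lmulw (projT1 (cid ex.2)) (l, r.2)
    else push e r
  else push e r.

Definition act (s : seq (G + E)) r :=
  foldr (fun x => match x with inl g => lmulw g | inr e => tact e end) r s.

Lemma teq_refl l m : teq 1 l m l m.
Proof.
elim: l => [|[g e] l IH] /=; first by rewrite mul1g.
by split=> //; exists 1, 1; split; rewrite ?invg1 ?mul1g ?mulg1.
Qed.

Lemma teq_sym a l m l' m' : teq a l m l' m' -> teq a^-1 l' m' l m.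
Proof.
elim: l l' a => [|[g e] l IH] [|[g' e'] l'] a //=; first by move=> ->; rewrite mulKg.
move=> [<- [p [q [apq -> /IH t]]]]; split=> //; exists p^-1, q^-1.
by split=> //; [exact: assocV|rewrite invgK mulgA mulgVK mulKg].
Qed.

Lemma teq_trans a b l m l' m' l'' m'' :
  teq a l m l' m' -> teq b l' m' l'' m'' -> teq (a * b) l m l'' m''.
Proof.
elim: l l' l'' a b => [|[g e] l IH] [|[g' e'] l'] [|[g'' e''] l''] a b //=.
  by move=> -> ->; rewrite mulgA.
move=> [<- [p [q [apq -> t]]]] [<- [p' [q' [apq' -> t']]]]; split=> //.
exists (p * p'), (q * q'); split; [exact: assocM|by rewrite invgM !mulgA|exact: IH t t'].
Qed.

Lemma teq_size a l m l' m' : teq a l m l' m' -> size l = size l'.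
Proof.
elim: l l' a => [|[g e] l IH] [|[g' e'] l'] a //=.
by move=> [_ [p [q [_ _ /IH ->]]]].
Qed.

Lemma teq_lmulwl b a r r' : teq a r.1 r.2 r'.1 r'.2 ->
  teq (b * a) (lmulw b r).1 (lmulw b r).2 r'.1 r'.2.
Proof.
case: r r' => [[|[g e] l] m] [[|[g' e'] l'] m'] //=; first by move=> ->; rewrite mulgA.
by move=> [<- [p [q [apq -> t]]]]; split=> //; exists p, q; rewrite !mulgA.
Qed.

Lemma teq_lmulwr b a r r' : teq (a * b) r.1 r.2 r'.1 r'.2 <->
  teq a r.1 r.2 (lmulw b r').1 (lmulw b r').2.
Proof.
case: r r' => [[|[g e] l] m] [[|[g' e'] l'] m'] //=; first by rewrite mulgA.
by split=> -[<- [p [q [apq -> t]]]]; split=> //; exists p, q; rewrite !mulgA.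
Qed.

Definition weq r r' := teq 1 r.1 r.2 r'.1 r'.2.

Lemma weq_refl r : weq r r. Proof. exact: teq_refl. Qed.
Lemma weq_sym r r' : weq r r' -> weq r' r.
Proof. by move=> /teq_sym; rewrite invg1. Qed.
Lemma weq_trans r r' r'' : weq r r' -> weq r' r'' -> weq r r''.
Proof. by move=> t t'; have := teq_trans t t'; rewrite mulg1. Qed.

Lemma weq_lmulw p q r r' : teq p r.1 r.2 r'.1 r'.2 -> weq (lmulw q r) (lmulw (q * p) r').
Proof.
by move=> t; apply/teq_lmulwr; rewrite mul1g; exact: teq_lmulwl.
Qed.

Lemma teq_lmulw g r : teq g (lmulw g r).1 (lmulw g r).2 r.1 r.2.
Proof. by rewrite -[X in teq X]mulg1; apply: teq_lmulwl; exact: teq_refl. Qed.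

Lemma lmulw1 r : lmulw 1 r = r.
Proof. by case: r => [[|[g e] l] m]; rewrite /lmulw /= mul1g. Qed.

Lemma lmulwM g h r : lmulw g (lmulw h r) = lmulw (g * h) r.
Proof. by case: r => [[|[k e] l] m]; rewrite /lmulw /= mulgA. Qed.

Lemma size_lmulw g r : size (lmulw g r).1 = size r.1.
Proof. by case: r => [[|[k e] l] m]. Qed.

Lemma path_nopinch x y l : x.2 = y.2 -> path nopinch x l = path nopinch y l.
Proof. by case: l => //= z l xy; rewrite /nopinch xy. Qed.

Lemma sorted_lmulw g r : sorted nopinch (lmulw g r).1 = sorted nopinch r.1.
Proof. by case: r => [[|[k e] l] m] //=; exact: path_nopinch. Qed.

Lemma tact_pinch e g f q l m : e = opp f -> assoc e g q ->
  tact e ((g, f) :: l, m) = lmulw q (l, m).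
Proof.
move=> ef a; rewrite /tact /=; case: pselect => [ex|[]]; last by split=> //; exists q.
by case: cid => q' /= a'; rewrite (assoc_fun a a').
Qed.

Lemma tact_push e r : (if r.1 is (g, f) :: _ then ~ pinch e g f else True) ->
  tact e r = push e r.
Proof. by case: r => [[|[g f] l] m] //= np; rewrite /tact /=; case: pselect. Qed.

Lemma sorted_tact e r : sorted nopinch r.1 -> sorted nopinch (tact e r).1.
Proof.
case: r => [[|[g f] l] m] //= s; rewrite /tact /=; case: pselect => [ex|np].
  by rewrite sorted_lmulw /=; exact: path_sorted s.
by rewrite /= s andbT; apply/asboolP.
Qed.

Lemma size_tact e r : (size (tact e r).1 <= (size r.1).+1)%N.
Proof.
case: r => [[|[g f] l] m] //=; rewrite /tact /=; case: pselect => [ex|np] //.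
by rewrite size_lmulw /= ltnW.
Qed.

(** Twisting changes the first element by a factor [q] that [f] associates to some [p]. If
    [e = opp f], then [q] is in the domain of [e], so both words pinch or neither does, and the
    results differ by the twist [p]. *)
Lemma weq_tact e r r' : weq r r' -> weq (tact e r) (tact e r').
Proof.
case: r r' => [[|[g f] l] m] [[|[g' f'] l'] m'] //.
  rewrite /weq /= mul1g => ->; split=> //; exists 1, 1.
  by split; rewrite ?invg1 ?mulg1 ?mul1g.
move=> t; have [ff' [p [q [apq gE tl]]]] := t; rewrite mul1g in gE; subst f'.
have g'E : g' = g * q by rewrite gE mulgVK.
have [[ef [s a]]|np] := pselect (pinch e g f).
  have aqp : assoc e q p by rewrite ef; exact: assoc_opp.
  rewrite (tact_pinch _ _ ef a) (@tact_pinch _ _ _ (s * p)) //.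
    exact: weq_lmulw.
  by rewrite g'E; exact: assocM.
have np' : ~ pinch e g' f.
  move=> [ef [s a]]; apply: np; split=> //; exists (s * p^-1).
  have aqp : assoc e q p by rewrite ef; exact: assoc_opp.
  by rewrite gE; apply: assocM => //; exact: assocV.
rewrite !tact_push //; split=> //; exists 1, 1.
by split=> //; rewrite invg1 !mulg1.
Qed.

Lemma weq_act s r r' : weq r r' -> weq (act s r) (act s r').
Proof.
move=> rr'; elim: s => [|[g|e] s IH] //=; last exact: weq_tact.
by rewrite -[X in weq _ (lmulw X _)]mulg1; exact: weq_lmulw.
Qed.

Lemma sorted_act s r : sorted nopinch r.1 -> sorted nopinch (act s r).1.
Proof.
move=> sr; elim: s => [|[g|e] s IH] //=; last exact: sorted_tact.
by rewrite sorted_lmulw.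
Qed.

Lemma act_cat s s' r : act (s ++ s') r = act s (act s' r).
Proof. exact: foldr_cat. Qed.

(** Either the first action pinches, and the second restores the removed letter up to a twist, or
    the first pushes a letter that the second removes. *)
Lemma tactK e r : sorted nopinch r.1 -> weq (tact (opp e) (tact e r)) r.
Proof.
move=> sr; suff [[g [q [l [m [rE a]]]]]|tE] :
    (exists g q l m, r = ((g, opp e) :: l, m) /\ assoc e g q) \/ tact e r = push e r.
- rewrite rE (tact_pinch _ _ _ a) ?oppK// tact_push; last first.
    (* A pinch of [opp e] with [q * h] would give one with [h], as [q] is in the domain of [opp e];
       but [r] is reduced. *)
    move: sr; rewrite rE /=; case: l {rE} => [|[h k] l] //= /andP[/asboolP np _] [/= ek [s b]].
    apply: np; split=> //=; exists (g^-1 * s); rewrite -[h](mulKg q).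
    by apply: assocM => //; apply: assocV; exact: assoc_opp.
  split=> //=; exists q, g; split; first exact: assoc_opp.
    by rewrite mul1g mulgV.
  exact: (teq_lmulw q (l, m)).
- by rewrite tE (@tact_pinch _ _ _ 1) // lmulw1; case: r {tE sr} => l m; exact: weq_refl.
case: r sr => [[|[g f] l] m] sr; first by right; exact: tact_push.
have [[ef [q a]]|np] := pselect (pinch e g f); last by right; exact: tact_push.
by left; exists g, q, l, m; rewrite ef oppK -ef.
Qed.

Lemma tact_lmulw e p q r : assoc e p q ->
  weq (tact e (lmulw p r)) (lmulw q (tact e r)).
Proof.
move=> a; have push_case : weq (push e (lmulw p r)) (lmulw q (push e r)).
  split=> //; exists p, q; split=> //; first by rewrite mulg1 mul1g mulgV.
  exact: teq_lmulw.
case: r push_case => [[|[g f] l] m] //= push_case.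
have [[ef [s b]]|np] := pselect (pinch e g f).
  rewrite (tact_pinch _ _ ef b) (@tact_pinch _ _ _ (q * s)) ?lmulwM //.
    exact: weq_refl.
  exact: assocM.
rewrite !tact_push //= => -[ef [s b]]; apply: np; split=> //; exists (q^-1 * s).
by rewrite -[g](mulKg p); apply: assocM => //; exact: assocV.
Qed.

(** * Conjugacy in HNN extensions *)

Section Group.
Variables (H : groupType) (eta : {multiplicative G -> H}) (t : E -> H).
Hypothesis t_opp : forall e, t e * t (opp e) = 1.
Hypothesis t_assoc : forall e p q, assoc e p q -> t e * eta p = eta q * t e.

Definition lval l : H := \prod_(x <- l) (eta x.1 * t x.2).
Definition nval r : H := lval r.1 * eta r.2.
Definition seqval (s : seq (G + E)) : H :=
  \prod_(x <- s) match x with inl g => eta g | inr e => t e end.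

Hypothesis seqval_surj : forall h, exists s, h = seqval s.
(** The action descends to [H], up to twisting: [H] has no relations beyond those that the action
    respects. *)
Hypothesis act_sound : forall s s' r,
  seqval s = seqval s' -> sorted nopinch r.1 -> weq (act s r) (act s' r).

Lemma lval_cons x l : lval (x :: l) = eta x.1 * t x.2 * lval l.
Proof. by rewrite /lval big_cons. Qed.

Lemma lval_nil : lval [::] = 1. Proof. by rewrite /lval big_nil. Qed.

Lemma lval_cat l l' : lval (l ++ l') = lval l * lval l'.
Proof. by rewrite /lval big_cat. Qed.

Lemma lval_rcons x l : lval (rcons l x) = lval l * (eta x.1 * t x.2).
Proof. by rewrite -cats1 lval_cat lval_cons lval_nil mulg1. Qed.

Lemma nval_lmulw g r : nval (lmulw g r) = eta g * nval r.
Proof.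
case: r => [[|[h e] l] m]; rewrite /nval /lmulw /= ?lval_nil ?lval_cons /= gmulfM;
  by rewrite ?mul1g ?mulgA.
Qed.

Lemma nval_push e r : nval (push e r) = t e * nval r.
Proof. by rewrite /nval lval_cons /= multiplicative1 mul1g mulgA. Qed.

Lemma nval_tact e r : nval (tact e r) = t e * nval r.
Proof.
case: r => [[|[g f] l] m]; first exact: nval_push.
have [[ef [q a]]|np] := pselect (pinch e g f); last by rewrite tact_push // nval_push.
rewrite (tact_pinch _ _ ef a) nval_lmulw /nval lval_cons /= !mulgA (t_assoc a).
by rewrite -[_ * t e * t f]mulgA ef -{2}[f]oppK t_opp mulg1.
Qed.

Lemma nval_act s r : nval (act s r) = seqval s * nval r.
Proof.
rewrite /seqval; elim: s => [|[g|e] s IH]; rewrite ?big_nil ?mul1g // big_cons -mulgA -IH /=.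
  by rewrite nval_lmulw.
by rewrite nval_tact.
Qed.

Definition syllables l m : seq (G + E) :=
  foldr (fun x s => [:: inl x.1, inr x.2 & s]) [:: inl m] l.

Lemma seqval_syllables l m : seqval (syllables l m) = lval l * eta m.
Proof.
rewrite /seqval; elim: l => [|x l IH] /=; first by rewrite big_seq1 lval_nil mul1g.
by rewrite !big_cons IH lval_cons !mulgA.
Qed.

Lemma act_syllables l m : sorted nopinch l -> act (syllables l m) ([::], 1) = (l, m).
Proof.
elim: l => [|[g e] l IH] /= sl; first by rewrite /lmulw /= mulg1.
rewrite IH ?(path_sorted sl) // tact_push /lmulw /= ?mulg1 //.
by case: l sl {IH} => [|[h f] l] //= /andP[/asboolP].
Qed.

Lemma size_act_syllables l m r : (size (act (syllables l m) r).1 <= size l + size r.1)%N.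
Proof.
elim: l => [|[g e] l IH] /=; first by rewrite size_lmulw.
by rewrite size_lmulw; apply: leq_trans (size_tact _ _) _.
Qed.

(** Letting any expression of [h] act on the empty word yields a reduced word of the same value. *)
Lemma reduced_exists h : exists l m, sorted nopinch l /\ h = lval l * eta m.
Proof.
have [s ->] := seqval_surj h; have := nval_act s ([::], 1).
have := @sorted_act s ([::], 1) isT; case: (act s _) => l m /= sl lE.
exists l, m; split=> //; move: lE; rewrite /nval /= => ->.
by rewrite lval_nil multiplicative1 !mulg1.
Qed.

(** Britton's lemma: a reduced word is recovered by letting its own syllables act on the empty word,
    and words of equal value act alike. *)
Lemma reduced_unique l m l' m' : sorted nopinch l -> sorted nopinch l' ->
  lval l * eta m = lval l' * eta m' -> teq 1 l m l' m'.
Proof.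
rewrite -!seqval_syllables => sl sl' ll'.
by have := @act_sound _ _ ([::], 1) ll' isT; rewrite !act_syllables.
Qed.

(** Acting on the empty word, [l'] creates at most one letter per stable letter, and the result is a
    twist of [l]. *)
Lemma reduced_geodesic l m l' m' : sorted nopinch l ->
  lval l * eta m = lval l' * eta m' -> (size l <= size l')%N.
Proof.
rewrite -!seqval_syllables => sl ll'.
have := @act_sound _ _ ([::], 1) ll' isT; rewrite act_syllables // => /teq_size /= ->.
by apply: leq_trans (size_act_syllables _ _ _) _; rewrite addn0.
Qed.

(* Let [t_e m] be the end of the conjugator. The word obtained by moving it to the
   right-hand side of [(z t_e m) x = y (z t_e m)] is too long to be reduced, so
   it pinches at an end of [x]; rotating [x] then shortens the conjugator. *)
Lemma conj_cyclic_reduced z m x y b :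
  sorted nopinch z -> x != [::] -> cycle nopinch x -> sorted nopinch y ->
  (size y <= size x)%N ->
  lval z * eta m * lval x = lval y * eta b * (lval z * eta m) ->
  exists i c, teq c y (b * c) (rot i x) 1.
Proof.
elim/last_ind: z m x => [|z [h e] IH] m x sz xn0 cx sy yx eqn.
  exists 0%N, m; rewrite rot0; rewrite lval_nil !mul1g -mulgA -gmulfM in eqn.
  have sx : sorted nopinch x by case: (x) cx => //= u k; rewrite rcons_path => /andP[].
  rewrite -[m in teq m]mul1g.
  apply/(@teq_lmulwr m 1 (y, b * m) (x, 1)).
  apply: reduced_unique; rewrite ?sorted_lmulw //.
  by rewrite -[RHS]/(nval (lmulw m (x, 1))) nval_lmulw /nval /= multiplicative1 mulg1 -eqn.
have sz' : sorted nopinch z.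
  by case: (z) sz => //= u k; rewrite rcons_path => /andP[].
rewrite lval_rcons /= in eqn.
(* Common to both pinches: [x] is conjugated by [u] to a rotation [x'], and [u] is absorbed at the
   end of the conjugator, which loses its last stable letter. *)
have step x' u : cycle nopinch x' -> size x' = size x -> (exists i, x' = rot i x) ->
    lval x = u * lval x' * u^-1 ->
    (exists g, lval z * (eta h * t e) * eta m * u = lval z * eta g) ->
    exists i c, teq c y (b * c) (rot i x) 1.
  move=> cx' x'x [i x'E] xu [g gE].
  have x'n0 : x' != [::] by rewrite -size_eq0 x'x size_eq0.
  have [||j [c]] := IH g x' sz' x'n0 cx' sy; first by rewrite x'x.
    rewrite -gE; apply: (mulIg u^-1).
    set zeta := lval z * _ * eta m in eqn *.
    have -> : zeta * u * lval x' * u^-1 = zeta * (u * lval x' * u^-1) by rewrite !mulgA.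
    by rewrite -xu eqn -!mulgA mulgV mulg1 /zeta -!mulgA.
  by rewrite x'E rot_rot_add => tc; exists (rot_add x i j), c.
(* Pinch at the left end of [x]: [t_e m x1 t_e1] collapses to [q], so the first letter of [x] is
   rotated away. *)
have [[x1 [e1 [x' [q [xE eE a]]]]]|npl] := pselect (exists x1 e1 x' q,
    [/\ x = (x1, e1) :: x', e = opp e1 & assoc e (m * x1) q]).
  apply: (step (rot 1 x) (eta x1 * t e1)); rewrite ?rot_cycle ?size_rot //.
  - by exists 1%N.
  - by rewrite xE rot1_cons lval_rcons lval_cons /= mulgA mulgK.
  exists (h * q); rewrite gmulfM -!mulgA; congr (_ * (_ * _)).
  rewrite [eta m * _]mulgA -gmulfM [LHS]mulgA (t_assoc a) -mulgA eE.
  by rewrite -{2}[e1]oppK t_opp mulg1.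
(* Pinch at the right end: [x] ends with [t_e], and [t_e m t_e^-1] collapses, so the last letter is
   rotated to the front. *)
have [[xn [x' [q [xE a]]]]|npr] := pselect (exists xn x' q,
    x = rcons x' (xn, e) /\ assoc e m^-1 q).
  apply: (step (rotr 1 x) (eta xn * t e)^-1); rewrite ?rotr_cycle ?size_rotr //.
  - by exists (size x - 1)%N.
  - by rewrite xE rotr1_rcons lval_rcons lval_cons /= invgK mulKg.
  have a' : assoc e m q^-1 by rewrite -[m]invgK; exact: assocV.
  exists (h * q^-1 * xn^-1); rewrite !gmulfM invgM (multiplicativeV _ xn) -!mulgA.
  by congr (_ * (_ * _)); rewrite mulgA (t_assoc a') -mulgA mulVKg.
exfalso.
case: x xn0 cx yx eqn npl npr {step} => [|[x1 e1] x] // _ cx yx eqn npl npr.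
(* Without a pinch, [z t_e m x m^-1 t_e^-1] is reduced with two more stable letters than [z] and [x]
   together, yet it equals [y b z h]. *)
suff : (size (rcons z (h, e) ++ (m * x1, e1) :: rcons x (m^-1, opp e))%g <=
        size (y ++ (lmulw b (z, h)).1))%N.
  rewrite !size_cat /= !size_rcons size_lmulw /= => le_sz; move: yx.
  by rewrite /= => yx; have := leq_trans le_sz (leq_add yx (leqnn _)); lia.
apply: (@reduced_geodesic _ 1 _ (lmulw b (z, h)).2); last first.
  have tV : t (opp e) = (t e)^-1 by apply/esym/mulg1_eq.
  rewrite multiplicative1 mulg1 [lval (y ++ _)]lval_cat -[RHS]mulgA.
  rewrite -/(nval (lmulw b (z, h))) nval_lmulw /nval /=.
  rewrite lval_cat lval_cons !lval_rcons /= gmulfM tV multiplicativeV.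
  rewrite lval_cons /= in eqn.
  set lx := lval x in eqn *; set ly := lval y in eqn *; set lz := lval z in eqn *.
  transitivity (lz * (eta h * t e) * eta m * (eta x1 * t e1 * lx) *
                ((eta m)^-1 * (t e)^-1)); first by rewrite !mulgA.
  by rewrite eqn -!mulgA mulVKg mulgV mulg1.
rewrite sorted_cat_cons -cats1 cat_rcons sorted_cat_cons sz /= rcons_path andbT.
apply/and3P; split.
- by apply/asboolP => -[/= eE [q a]]; apply: npl; exists x1, e1, x, q.
- by move: cx; rewrite /= rcons_path => /andP[px _]; rewrite (@path_nopinch _ (x1, e1)).
apply/asboolP => -[/= eE [q a]]; apply: npr.
(* The stable letter before [m^-1 t_e^-1] is the last one of the cyclic word, which is [e1] when
   that word has a single letter. *)
move: eE; rewrite oppK; case/lastP: x {cx yx eqn npl} a => [|x [xn en]] /=.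
  by move=> a e1E; exists x1, [::], q; rewrite -e1E; move: a; rewrite e1E.
rewrite last_rcons /= => a enE; exists xn, ((x1, e1) :: x), q.
by rewrite -enE; move: a; rewrite enE.
Qed.

(* Otherwise [z t_e (m a m^-1) t_e^-1] would be reduced, and longer than the word
   [b z h], which has the same value. *)
Lemma conj_base z h e m a b : sorted nopinch (rcons z (h, e)) ->
  lval (rcons z (h, e)) * eta m * eta a = eta b * (lval (rcons z (h, e)) * eta m) ->
  exists q, assoc e (m * a * m^-1) q /\
    lval z * eta h * eta q = eta b * (lval z * eta h).
Proof.
rewrite lval_rcons /= => sz eqn.
have tV : t (opp e) = (t e)^-1 by apply/esym/mulg1_eq.
have eqn' : lval z * eta h * (t e * eta (m * a * m^-1)) = eta b * (lval z * eta h) * t e.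
  rewrite !gmulfM multiplicativeV; apply: (mulIg (eta m)).
  transitivity (lval z * (eta h * t e) * eta m * eta a); first by rewrite -!mulgA mulVg mulg1.
  by rewrite eqn !mulgA.
have [[q aq]|np] := pselect (exists q, assoc e (m * a * m^-1) q).
  exists q; split=> //; move: eqn'; rewrite (t_assoc aq) !mulgA; exact: mulIg.
exfalso.
suff : (size (rcons (rcons z (h, e)) (m * a * m^-1, opp e))%g <= size (lmulw b (z, h)).1)%N.
  by rewrite size_lmulw !size_rcons /=; lia.
apply: (@reduced_geodesic _ 1 _ (lmulw b (z, h)).2); last first.
  rewrite -/(nval (lmulw b (z, h))) nval_lmulw /nval /= multiplicative1 mulg1.
  rewrite !lval_rcons /= tV !mulgA; move: eqn'; rewrite !mulgA => ->.
  by rewrite -!mulgA mulgV mulg1.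
rewrite -cats1 cat_rcons sorted_cat_cons sz /= andbT.
by apply/asboolP => -[_ /= ex]; apply: np.
Qed.

(** Exchanging the words and inverting [k], [y] may be assumed no longer than [x]. It is then a
    twist of a rotation of [x], and neither operation changes the length. *)
Lemma conj_cyclic_size (k : H) x y b c :
  cycle nopinch x -> cycle nopinch y -> (x != [::] -> c = 1) -> (y != [::] -> b = 1) ->
  k * (lval x * eta c) = lval y * eta b * k -> size x = size y.
Proof.
wlog yx : k x y b c / (size y <= size x)%N => [wl cx cy c1 b1 eqn|].
  have [/wl|/ltnW xy] := leqP (size y) (size x); first by apply; eassumption.
  apply/esym; apply: (wl k^-1 y x c b xy cy cx b1 c1).
  by apply: (mulgI k); rewrite mulVKg !mulgA -[k * _ * _]mulgA eqn mulgK.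
move=> cx cy c1 _; case: (altP (x =P [::])) => [x0 _|xn0].
  by move: yx; rewrite x0; case: (y).
rewrite c1 // multiplicative1 mulg1; have [z [m [sz ->]]] := reduced_exists k.
have sy : sorted nopinch y by case: (y) cy => //= u s; rewrite rcons_path => /andP[].
by move=> /(conj_cyclic_reduced sz xn0 cx sy yx) [i [d /teq_size]]; rewrite size_rot.
Qed.

End Group.
End NormalForms.

HB.instance Definition _ (X : graph_of_groups) :=
  Equality.copy (edge X) (geom_edge X * bool)%type.

(** * Relations in the fundamental group of a graph of groups *)

Section PathGroupMorphisms.
Variables (X : graph_of_groups) (T : set (geom_edge X)).
Local Open Scope quotient_scope.

Lemma gog_mulE s1 s2 :
  (\pi_(pi1_gog T) s1 : pi1_gog T) * \pi_(pi1_gog T) s2 = \pi_(pi1_gog T) (s1 ++ s2).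
Proof. exact: gog_pi_mul. Qed.

Lemma gog_vertexM v : {morph @gog_vertex X T v : g h / g * h}.
Proof. by move=> g h; rewrite gog_mulE; apply/esym/gogP/gen_rel_mul. Qed.

HB.instance Definition _ v := isMultiplicative.Build _ _ (@gog_vertex X T v) (@gog_vertexM v).

Lemma gog_edge_bar e : gog_edge T e * gog_edge T (bar e) = 1.
Proof. by rewrite gog_mulE; apply/gogP/gen_rel_bar. Qed.

Lemma gog_edgeM e (c : egroup e.1) :
  gog_edge T e * gog_vertex T (phip c) = gog_vertex T (phim c) * gog_edge T e.
Proof.
have -> : gog_vertex T (phim c) =
    gog_edge T e * gog_vertex T (phip c) * gog_edge T (bar e).
  by rewrite [X in X * _]gog_mulE gog_mulE; apply/esym/gogP; exact: gen_rel_edge.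
by rewrite -(mulg1_eq (gog_edge_bar e)) mulgVK.
Qed.

End PathGroupMorphisms.

(** * The one-vertex graph of groups *)

Section Bouquet.
Variable X : graph_of_groups.

Definition vprod := forall v : vertex X, vgroup v.

HB.instance Definition _ := gen_eqMixin vprod.
HB.instance Definition _ := gen_choiceMixin vprod.

Definition vprod_mul (f g : vprod) : vprod := fun v => f v * g v.
Definition vprod_inv (f : vprod) : vprod := fun v => (f v)^-1.
Definition vprod_one : vprod := fun v => 1.

Lemma vprod_mulA : associative vprod_mul.
Proof. by move=> f g h; apply/functional_extensionality_dep => v; exact: mulgA. Qed.
Lemma vprod_mul1 : left_id vprod_one vprod_mul.
Proof. by move=> f; apply/functional_extensionality_dep => v; exact: mul1g. Qed.
Lemma vprod_1mul : right_id vprod_one vprod_mul.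
Proof. by move=> f; apply/functional_extensionality_dep => v; exact: mulg1. Qed.
Lemma vprod_mulV : left_inverse vprod_one vprod_inv vprod_mul.
Proof. by move=> f; apply/functional_extensionality_dep => v; exact: mulVg. Qed.
Lemma vprod_Vmul : right_inverse vprod_one vprod_inv vprod_mul.
Proof. by move=> f; apply/functional_extensionality_dep => v; exact: mulgV. Qed.

HB.instance Definition _ := isGroup.Build vprod
  vprod_mulA vprod_mul1 vprod_1mul vprod_mulV vprod_Vmul.

Definition vinj v (g : vgroup v) : vprod :=
  @dfwith _ (fun u => vgroup u) (1 : vprod) v g.

Lemma vinj_in v (g : vgroup v) : vinj g v = g.
Proof. exact: dfwith_in. Qed.

Lemma vinj_out v (g : vgroup v) u : v != u -> vinj g u = 1.
Proof. exact: dfwith_out. Qed.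

Lemma vinj_inj v : injective (@vinj v).
Proof. by move=> g h gh; rewrite -(vinj_in g) gh vinj_in. Qed.

Lemma vinjM v : {morph @vinj v : g h / g * h}.
Proof.
move=> g h; apply/functional_extensionality_dep => u; rewrite -[RHS]/(vinj g u * vinj h u).
have [uv|vu] := eqVneq v u; last by rewrite !vinj_out ?mulg1.
by case: _ / uv; rewrite !vinj_in.
Qed.

HB.instance Definition _ v := isMultiplicative.Build _ _ (@vinj v) (@vinjM v).

(** Compare the coordinates at [u]: if [v] differed from [u], the right-hand side would be 1 there
    and force [g = 1]. *)
Lemma vinj_conj u v (g : vgroup u) (h : vgroup v) (m : vprod) :
  g <> 1 -> m * vinj g * m^-1 = vinj h ->
  exists vu : v = u, conj_in g (eq_rect v (@vgroup X) h u vu).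
Proof.
move=> g1 gh; have gh_u : m u * g * (m u)^-1 = vinj h u by rewrite -gh -[g in LHS](vinj_in g).
have [vu|nvu] := eqVneq v u.
  exists vu; case: _ / vu g {g1 gh} gh_u => g; rewrite vinj_in => <- /=.
  by exists (m v)^-1; rewrite conjgE invgK mulgA.
case: g1; move: gh_u; rewrite vinj_out // => gh_u.
by apply: (mulgI (m u)); rewrite mulg1; apply: divg1_eq.
Qed.

Definition edge_vinj j b : {multiplicative @egroup X j -> vprod} :=
  @vinj (endpoint j b) \o edge_mono j b.

Lemma edge_vinj_inj j b : injective (edge_vinj j b).
Proof. by apply: inj_comp; [exact: vinj_inj|exact: edge_mono_inj]. Qed.

(* Its path group is a multiple HNN extension of the direct product of the vertex
   groups of X, in which words carry no typing constraint. *)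
Definition bouquet : graph_of_groups :=
  @GraphOfGroups unit (geom_edge X) (fun _ _ => tt) (fun=> vprod) (@egroup X)
    edge_vinj edge_vinj_inj.

Definition hnn := @pi1_gog bouquet set0.
Definition eta : vprod -> hnn := @gog_vertex bouquet set0 tt.

Lemma etaM : {morph eta : g h / g * h}.
Proof. exact: (@gog_vertexM bouquet). Qed.

HB.instance Definition _ := isMultiplicative.Build _ _ eta etaM.

Definition stable (e : edge X) : hnn := @gog_edge bouquet set0 e.

(** The pairs [(c^+, c^-)], matching the relation [t_e c^+ t_e^-1 = c^-]. *)
Definition edge_assoc (e : edge X) (p q : vprod) :=
  exists c : egroup e.1, p = vinj (phip c) /\ q = vinj (phim c).

Lemma edge_assoc1 e : edge_assoc e 1 1.
Proof. by exists 1; rewrite /phip /phim !multiplicative1. Qed.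

Lemma edge_assocM e p q p' q' :
  edge_assoc e p q -> edge_assoc e p' q' -> edge_assoc e (p * p') (q * q').
Proof.
by move=> [c [-> ->]] [c' [-> ->]]; exists (c * c'); rewrite /phip /phim !gmulfM.
Qed.

Lemma edge_assocV e p q : edge_assoc e p q -> edge_assoc e p^-1 q^-1.
Proof.
by move=> [c [-> ->]]; exists c^-1; rewrite /phip /phim !multiplicativeV.
Qed.

Lemma edge_assoc_fun e p q q' : edge_assoc e p q -> edge_assoc e p q' -> q = q'.
Proof.
by move=> [c [-> ->]] [c' [/(@edge_vinj_inj e.1 (~~ e.2)) -> ->]].
Qed.

Lemma edge_assoc_bar e p q : edge_assoc e p q -> edge_assoc (bar e) q p.
Proof. by case: e => j [] [c [-> ->]]; exists c. Qed.

Lemma stable_bar e : stable e * stable (bar e) = 1.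
Proof. exact: (@gog_edge_bar bouquet). Qed.

Lemma stable_assoc e p q : edge_assoc e p q -> stable e * eta p = eta q * stable e.
Proof. by move=> [c [-> ->]]; exact: (@gog_edgeM bouquet set0 e c). Qed.

Local Notation bact := (@act vprod (edge X) (@bar X) edge_assoc).
Local Notation bweq := (@weq vprod (edge X) edge_assoc).
Local Notation bnopinch := (@nopinch vprod (edge X) (@bar X) edge_assoc).

Definition letter_of (x : {v : vertex bouquet & vgroup v} + edge bouquet) :
    vprod + edge X :=
  match x with inl g => inl (tagged g) | inr e => inr e end.

Definition of_letter (x : vprod + edge X) :
    {v : vertex bouquet & vgroup v} + edge bouquet :=
  match x with inl g => @vgen bouquet tt g | inr e => @tgen bouquet e end.

(** Only two kinds of relation need an argument: [tactK] handles [t_e t_(bar e) = 1], and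
    [tact_lmulw] the edge relations. The tree is empty here, so no stable letter is killed. *)
Lemma act_gen_rel s s' : @gen_rel bouquet set0 s s' -> forall r, sorted bnopinch r.1 ->
  bweq (bact (map letter_of s) r) (bact (map letter_of s') r).
Proof.
have weqr := @weq_refl _ _ _ edge_assoc1.
have weqt := @weq_trans _ _ _ edge_assocM.
have tactV e r : sorted bnopinch r.1 ->
    bweq (tact (@bar X) edge_assoc e (tact (@bar X) edge_assoc (bar e) r)) r.
  move=> sr; rewrite -{1}[e]barK; apply: tactK => //;
    [exact: barK|exact: edge_assoc1|exact: edge_assocM|exact: edge_assocV|
     exact: edge_assoc_fun|exact: edge_assoc_bar].
elim=> {s s'} [s|s s' _ IH|s s' s'' _ IH _ IH'|s1 s2 s3 s4 _ IH _ IH'|v|v g h|e|e c|e []] r sr /=.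
- exact: weqr.
- by apply: (weq_sym edge_assocV); exact: IH.
- exact: weqt (IH r sr) (IH' r sr).
- rewrite !map_cat !act_cat; apply: weqt (IH _ _) _; first exact: sorted_act.
  by apply: weq_act (IH' r sr); [exact: edge_assoc1|exact: edge_assocM|exact: edge_assocV|
     exact: edge_assoc_fun|exact: edge_assoc_bar].
- by rewrite lmulw1; exact: weqr.
- by rewrite lmulwM; exact: weqr.
- exact: tactV.
- have ca : edge_assoc e (vinj (@phip X e c)) (vinj (@phim X e c)) by exists c.
  apply: (@weqt _ (lmulw (vinj (@phim X e c))
    (tact (@bar X) edge_assoc e (tact (@bar X) edge_assoc (bar e) r)))).
    by apply: tact_lmulw ca; [exact: edge_assoc1|exact: edge_assocM|
      exact: edge_assocV|exact: edge_assoc_fun].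
  rewrite -[X in bweq _ (lmulw X _)]mulg1; apply: weq_lmulw; exact: tactV.
Qed.

Local Notation bseqval := (seqval eta stable).

Local Open Scope quotient_scope.

Lemma bseqval_pi s : bseqval s = \pi_hnn (map of_letter s).
Proof.
rewrite /seqval; elim: s => [|x s IH]; first by rewrite big_nil.
by rewrite big_cons IH; case: x => a; rewrite [LHS]gog_mulE.
Qed.

Lemma of_letterK : cancel of_letter letter_of. Proof. by case. Qed.
Lemma letter_ofK : cancel letter_of of_letter. Proof. by case=> // -[[] g]. Qed.

Lemma bseqval_surj h : exists s, h = bseqval s.
Proof.
have [s ->] := gog_ex h; exists (map letter_of s).
by rewrite bseqval_pi (mapK letter_ofK).
Qed.

Lemma bact_sound s s' r : bseqval s = bseqval s' -> sorted bnopinch r.1 ->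
  bweq (bact s r) (bact s' r).
Proof.
rewrite !bseqval_pi => /gogP/act_gen_rel ss' /ss'; by rewrite !(mapK of_letterK).
Qed.

End Bouquet.

(** * Words without typing constraint *)

Section Untyped.
Variable X : graph_of_groups.
Local Notation V := (vertex X).
Local Notation G := (vprod X).
Local Notation nopinch := (@nopinch G (edge X) (@bar X) (@edge_assoc X)).
Local Notation teq := (@teq G (edge X) (@edge_assoc X)).
Local Notation eta := (@eta X).
Local Notation lval := (@lval G (edge X) (hnn X) eta (@stable X)).
Local Notation lnil := (@enil X (fun e => vgroup (orig e))).
Local Notation lcons := (@econs X (fun e => vgroup (orig e))).

Fixpoint untype u v (l : letters u v) : seq (G * edge X) :=
  if l is econs e _ mu l' then (vinj mu, e) :: untype l' else [::].

Lemma size_untype u v (l : letters u v) : size (untype l) = elength l.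
Proof. by elim: l => //= e w mu l ->. Qed.

Lemma untype_cat u v w (l : letters u v) (l' : letters v w) :
  untype (ecat l l') = untype l ++ untype l'.
Proof. by elim: l l' => //= e z mu l IH l'; rewrite IH. Qed.

Lemma ecat_nil D u v (p : epath D u v) : ecat p (@enil X D v) = p.
Proof. by elim: p => //= e w d p ->. Qed.

Lemma elength0 (D : edge X -> Type) u v (p : epath D u v) : elength p = 0%N ->
  exists h : u = v, p = eq_rect u (fun w => epath D u w) (@enil X D u) v h.
Proof. by case: p => [w|//] _; exists erefl. Qed.

Lemma elength0_loop (D : edge X -> Type) u (p : epath D u u) :
  elength p = 0%N -> p = @enil X D u.
Proof. by case/elength0 => h ->; rewrite (eq_axiomK h). Qed.

Lemma untype_cons u v (l : letters u v) g e L : untype l = (g, e) :: L ->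
  exists (h : orig e = u) (mu : vgroup (orig e)) (l1 : letters (extr e) v),
    [/\ l = eq_rect (orig e) (fun w => letters w v) (lcons mu l1) u h,
        g = vinj mu & L = untype l1].
Proof.
case: l => [w|e' w mu l1] //= [<- ee' <-]; case: _ / ee'.
by exists erefl, mu, l1.
Qed.

Lemma untype_cat_inv u v (l : letters u v) L1 L2 : untype l = L1 ++ L2 ->
  exists w (l1 : letters u w) (l2 : letters w v),
    [/\ l = ecat l1 l2, untype l1 = L1 & untype l2 = L2].
Proof.
elim: L1 u l => [|[g e] L1 IH] u l /=; first by exists u, (lnil u), l.
move=> /untype_cons[h [mu [l1 [-> ->]]]]; case: _ / h => /esym/IH[w [k1 [k2 [-> <- <-]]]].
by exists w, (lcons mu k1), k2.
Qed.

Lemma cyclic_conj_ecat u v (l1 : letters u v) (l2 : letters v u) :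
  cyclic_conj (@Word X _ (ecat l1 l2) 1) (@Word X _ (ecat l2 l1) 1).
Proof.
case: l1 l2 => [w|e w mu l1] l2 /=.
  by rewrite ecat_nil; exact: cyclic_conj_refl.
by have := cyclic_conj_rot mu l1 l2 1; rewrite mul1g.
Qed.

Lemma cyclic_conj_rotation u (l : letters u u) i :
  exists v (l' : letters v v),
    untype l' = rot i (untype l) /\ cyclic_conj (@Word X _ l 1) (@Word X _ l' 1).
Proof.
have [w [l1 [l2 [lE l1E l2E]]]] := untype_cat_inv (esym (cat_take_drop i (untype l))).
exists w, (ecat l2 l1); rewrite untype_cat l1E l2E; split=> //.
by rewrite lE; exact: cyclic_conj_ecat.
Qed.

Lemma first_avoids_untype e u v (l : letters u v) S g f L :
  untype l = (g, f) :: L -> first_avoids e l S -> e = bar f ->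
  exists2 mu : vgroup u, g = vinj mu & ~ S mu.
Proof.
by case: l S => [w|e' w mu l] S //= [<- <- _] av ee'; exists mu; last exact: av.
Qed.

Lemma letters_reduced_sorted u v (l : letters u v) :
  letters_reduced l -> sorted nopinch (untype l).
Proof.
elim: l => //= e w mu l' IH [av /IH].
case E: (untype l') => [|[g f] L] //= ->; rewrite andbT.
apply/asboolP => -[/= ef [q [c [gE _]]]].
have [nu nuE] := first_avoids_untype E av ef; apply.
by exists c => //; apply: vinj_inj; rewrite -nuE.
Qed.

(** After each edge the twist is some [c^+], hence at the end of the path it lies in the group of
    the last vertex. *)
Lemma teq_last_vinj u v (l : letters u v) (a : vgroup u) m L m' :
  teq (vinj a) (untype l) m L m' -> exists g : vgroup v, m = vinj g * m'.
Proof.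
elim: l a L => [w|e w mu l IH] a [|[g' e'] L] //=; first by exists a.
by move=> [_ [p [q [[c [-> _]] _ /IH]]]].
Qed.

Lemma teq_twisted u v (l l' : letters u v) (a : vgroup u) m m' :
  teq (vinj a) (untype l) m (untype l') m' ->
  exists c : echain u v, [/\ elength c = elength l, twisted a c l l' &
    m = vinj (chain_last c a) * m'].
Proof.
elim: l l' a => [w|e w mu l IH] l' a.
  case E: (untype l') => //= mE; exists (enil _ w); split=> //.
  by rewrite (@elength0_loop _ _ l') -?size_untype ?E //; exact: twisted_nil.
case E: (untype l') => [|[g e'] L] //= [ee' [p [q [[c [-> ->]] gE]]]].
(* Vertices have decidable equality, so the proof [h] that the origins agree is [erefl] and the
   transport disappears. *)
case: _ / ee' E => /untype_cons[h [mu' [l1 [-> g'E ->]]]]; rewrite (eq_axiomK h) /=.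
move=> /IH[c' [sz tw mE]]; exists (econs (D := fun e => egroup e.1) c c'); split=> //=.
- by rewrite sz.
- apply: twisted_cons tw; apply: vinj_inj.
  by rewrite gE g'E !gmulfM multiplicativeV.
Qed.

Lemma chain_last_pos u v (c : echain u v) (a a' : vgroup u) :
  (0 < elength c)%N -> @chain_last X _ _ c a = @chain_last X _ _ c a'.
Proof. by case: c a a'. Qed.

(** Induction on the conjugator: by [conj_base] its last edge [e] has some [c^+] conjugate to [g],
    and [c^-] is then conjugated to [g'] by a shorter element. *)
Lemma hnn_conj_chain z m a b (g : vgroup a) (g' : vgroup b) :
  sorted nopinch z -> g <> 1 ->
  lval z * eta m * eta (vinj g) = eta (vinj g') * (lval z * eta m) ->
  exists c : echain a b, chain_conj c g g'.
Proof.
elim/last_ind: z m a g => [|z [h e] IH] m a g sz g1.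
  rewrite lval_nil !mul1g -!gmulfM => eqn.
  have /= mE : teq 1 [::] (m * vinj g) [::] (vinj g' * m).
    by apply: (reduced_unique (@bact_sound X)); rewrite ?lval_nil ?mul1g.
  have [|ba] := @vinj_conj X a b g g' m g1; first by rewrite mE mul1g mulgK.
  by case: _ / ba g {mE eqn g1} => g cj; exists (enil _ b).
move=> /(conj_base (@stable_bar X) (@stable_assoc X) (@bact_sound X) sz) [q [[c [cE ->]] eqn]].
have [uv cj] := vinj_conj g1 cE.
(* A nontrivial [c] is what lets the induction hypothesis apply to [c^-]. *)
have c1 : c <> 1.
  move=> c1; apply: g1; apply: vinj_inj; apply: (mulIg m^-1); apply: (mulgI m).
  by rewrite mulgA cE c1 /phip !multiplicative1 mul1g mulgV.
move: sz eqn; rewrite -cats1 => /cat_sorted2[sz _] /IH -/(_ sz) {}IH.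
case: _ / uv g {cE g1} cj => g /= cj.
have [|c' cc'] := IH.
  rewrite /phim => c0; apply: c1; apply: (@edge_mono_inj X e.1 e.2).
  by rewrite c0 multiplicative1.
(* The chain crosses [e] from its extremity to its origin, so its first edge is [bar e]; splitting
   on the orientation makes the end points compute. *)
by case: e c c1 c' cc' g cj {sz IH} => j [] c c1 c' cc' g cj;
  [exists (@econs X (fun e => egroup e.1) (j, false) b c c')|
   exists (@econs X (fun e => egroup e.1) (j, true) b c c')].
Qed.

End Untyped.

(** * The morphism to the HNN extension *)

Section Comparison.
Variables (X : graph_of_groups) (T : set (geom_edge X)).
Local Notation V := (vertex X).
Local Notation H := (hnn X).
Local Notation eta := (@eta X).
Local Notation lval := (@lval (vprod X) (edge X) (hnn X) eta (@stable X)).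

(** Edge paths as plain lists, so that cutting and reversing them involves no dependent types. *)
Fixpoint walk (u : V) (s : seq (edge X)) (v : V) : bool :=
  if s is e :: s' then (orig e == u) && walk (extr e) s' v else u == v.

Definition stables (s : seq (edge X)) : H := \prod_(e <- s) stable e.

Lemma stables_cat s s' : stables (s ++ s') = stables s * stables s'.
Proof. by rewrite /stables big_cat. Qed.

Lemma walk_cat u s w s' v : walk u s w -> walk w s' v -> walk u (s ++ s') v.
Proof. by elim: s u => [|e s IH] u /= => [/eqP->|/andP[-> /IH]]. Qed.

Lemma walk_cat_inv u s s' v : walk u (s ++ s') v ->
  exists w, walk u s w /\ walk w s' v.
Proof.
elim: s u => [|e s IH] u /=; first by exists u; rewrite eqxx.
by move=> /andP[-> /IH[w [sw w's]]]; exists w.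
Qed.

Lemma extr_bar (e : edge X) : extr (bar e) = orig e.
Proof. by case: e => j []. Qed.

Lemma walk_rev u s v : walk u s v -> walk v (rev (map (@bar X) s)) u.
Proof.
elim: s u => [|e s IH] u /=; first by rewrite eq_sym.
move=> /andP[/eqP <- /IH]; rewrite rev_cons -cats1 => sv.
by apply: walk_cat sv _; rewrite /= extr_bar !eqxx.
Qed.

Lemma stable_inv (e : edge X) : stable (bar e) = (stable e)^-1.
Proof. exact/esym/mulg1_eq/stable_bar. Qed.

Lemma stables_rev s : stables (rev (map (@bar X) s)) = (stables s)^-1.
Proof.
rewrite /stables; elim: s => [|e s IH]; first by rewrite !big_nil invg1.
by rewrite /= rev_cons -cats1 big_cat big_seq1 /= IH big_cons invgM stable_inv.
Qed.

Lemma walk_of_epath u v (p : epath (fun=> unit) u v) : edges_in T p ->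
  exists s, walk u s v /\ forall e, e \in s -> T e.1.
Proof.
elim: p => [w|e w _ p IH] /=; first by exists [::]; rewrite /= eqxx.
move=> [Te /IH[s [ws Ts]]]; exists (e :: s); rewrite /= eqxx; split=> // f.
by rewrite inE => /predU1P[->|/Ts].
Qed.

Lemma epath_of_walk u s v : walk u s v -> (forall e, e \in s -> T e.1) ->
  sorted (fun e f => f != bar e) s ->
  exists p : epath (fun=> unit) u v,
    [/\ edges_in T p, backtrack_free p, first_edge p = ohead s & elength p = size s].
Proof.
elim: s u => [|e s IH] u /=; first by move=> /eqP<- _ _; exists (enil _ u).
move=> /andP[/eqP <- ws] Ts es.
have [|p [pT pb pf ps]] := IH _ ws _ (path_sorted es).
  by move=> f fs; apply: Ts; rewrite inE fs orbT.
exists (econs (D := fun=> unit) tt p); split=> //=.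
- by split=> //; apply: Ts; rewrite inE eqxx.
- split=> //; rewrite pf; case: (s) es => //= f s' /andP[/eqP + _] [].
  by [].
- by rewrite ps.
Qed.

Lemma unsorted_split (A : Type) (r : rel A) (s : seq A) : ~~ sorted r s ->
  exists s1 x y s2, s = s1 ++ [:: x, y & s2] /\ ~~ r x y.
Proof.
case: s => //= x s; elim: s x => //= y s IH x; rewrite negb_and => /orP[nxy|/IH].
  by exists [::], x, y, s.
by move=> [s1 [x' [y' [s2 [-> nr]]]]]; exists (x :: s1), x', y', s2.
Qed.

Hypothesis T_tree : maximal_tree T.

(** Deleting a backtrack [e, bar e] does not change the product, and a closed walk in a tree without
    backtracks is empty. *)
Lemma stables_tree_loop s v : walk v s v -> (forall e, e \in s -> T e.1) ->
  stables s = 1.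
Proof.
have [n] := ubnP (size s); elim: n s => // n IH s /ltnSE sn ws Ts.
have [ss|] := boolP (sorted (fun e f => f != bar e) s).
  have [p [pT pb _ ps]] := epath_of_walk ws Ts ss.
  have := T_tree.2 _ _ pT pb; rewrite ps => /size0nil ->.
  by rewrite /stables big_nil.
move=> /unsorted_split[s1 [e [f [s2 [sE /negPn/eqP fE]]]]]; subst f s.
have -> : stables (s1 ++ [:: e, bar e & s2]) = stables (s1 ++ s2).
  by rewrite /stables !big_cat !big_cons /= [stable e * _]mulgA stable_bar mul1g.
apply: IH; first by move: sn; rewrite !size_cat /=; lia.
- have [w [w1 /= /andP[/eqP ew /andP[_]]]] := walk_cat_inv ws.
  by rewrite extr_bar ew; exact: walk_cat.
- by move=> f fs; apply: Ts; move: fs; rewrite !mem_cat !inE => /orP[] ->; rewrite ?orbT.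
Qed.

(** [P v] is the product of the stable letters along a walk in the tree from [v0] to [v]. *)
Lemma tree_potential (v0 : V) : exists P : V -> H,
  forall e, T e.1 -> P (orig e) * stable e = P (extr e).
Proof.
have tp v : exists s, walk v0 s v /\ forall e, e \in s -> T e.1.
  by have [p pT] := T_tree.1 v0 v; exact: walk_of_epath pT.
pose s v := projT1 (cid (tp v)).
have sP v : walk v0 (s v) v /\ forall e, e \in s v -> T e.1 by exact: projT2 (cid (tp v)).
exists (fun v => stables (s v)) => e Te.
(* The closed walk in the tree goes to the origin of [e], crosses [e], and returns from its
   extremity. *)
suff : stables (s (orig e) ++ e :: rev (map (@bar X) (s (extr e)))) = 1.
  rewrite stables_cat -cat1s stables_cat stables_rev {2}/stables big_seq1 mulgA.
  by move=> /divg1_eq.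
apply: (@stables_tree_loop _ v0).
  apply: walk_cat (sP _).1 _; rewrite /= eqxx /=; exact: walk_rev (sP _).1.
move=> f; rewrite mem_cat inE mem_rev => /or3P[/(sP _).2//|/eqP->//|].
by move=> /mapP[g /(sP _).2 Tg ->].
Qed.

Variable P : V -> H.
Hypothesis P_tree : forall e, T e.1 -> P (orig e) * stable e = P (extr e).

Definition to_hnn_gen (x : {v : V & vgroup v} + edge X) : H :=
  match x with
  | inl g => P (tag g) * eta (vinj (tagged g)) * (P (tag g))^-1
  | inr e => P (orig e) * stable e * (P (extr e))^-1
  end.

Definition to_hnn_word (s : gen_word X) : H := \prod_(x <- s) to_hnn_gen x.

(** The potentials cancel between adjacent letters, which leaves the relations of [H]; for [t_e = 1]
    on the tree, [P_tree] is used. *)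
Lemma to_hnn_word_rel s s' : gen_rel T s s' -> to_hnn_word s = to_hnn_word s'.
Proof.
rewrite /to_hnn_word; elim=> {s s'}
  [s|s s' _ ->|s s' s'' _ -> _ ->|s1 s2 s3 s4 _ IH _ IH'|v|v g h|e|e c|e Te] //.
- by rewrite !big_cat /= IH IH'.
- by rewrite big_seq1 big_nil /= !multiplicative1 mulg1 mulgV.
- by rewrite !big_cons !big_nil /= !mulg1 !mulgA mulgVK !gmulfM !mulgA.
- rewrite !big_cons !big_nil /= mulg1 extr_bar -[orig (bar e)]/(extr e).
  by rewrite !mulgA mulgVK -[P _ * _ * _]mulgA stable_bar mulg1 mulgV.
- rewrite !big_cons !big_nil /= !mulg1 extr_bar -[orig (bar e)]/(extr e).
  rewrite !mulgA !mulgVK -[P _ * _ * eta _]mulgA.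
  rewrite (@stable_assoc X e _ (vinj (phim c))); last by exists c.
  by rewrite mulgA -[_ * stable e * _]mulgA stable_bar mulg1.
- by rewrite big_seq1 big_nil /= P_tree // mulgV.
Qed.

Local Open Scope quotient_scope.

Definition to_hnn (a : pi1_gog T) : H := to_hnn_word (repr a).

Lemma to_hnn_pi s : to_hnn (\pi_(pi1_gog T) s) = to_hnn_word s.
Proof. by apply: to_hnn_word_rel; apply/(gogP T); rewrite reprK. Qed.

Lemma to_hnnM : {morph to_hnn : a b / a * b}.
Proof.
move=> a b; have [s ->] := gog_ex a; have [s' ->] := gog_ex b.
by rewrite gog_mulE !to_hnn_pi /to_hnn_word big_cat.
Qed.

HB.instance Definition _ := isMultiplicative.Build _ _ to_hnn to_hnnM.

Lemma to_hnn_vertex v (g : vgroup v) :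
  to_hnn (gog_vertex T g) = P v * eta (vinj g) * (P v)^-1.
Proof. by rewrite to_hnn_pi /to_hnn_word big_seq1. Qed.

Lemma to_hnn_edge e : to_hnn (gog_edge T e) = P (orig e) * stable e * (P (extr e))^-1.
Proof. by rewrite to_hnn_pi /to_hnn_word big_seq1. Qed.

(** The potentials telescope along the path, so only those of its end points remain. *)
Lemma to_hnn_letters u v (l : letters u v) :
  to_hnn (letters_label T l) = P u * lval (untype l) * (P v)^-1.
Proof.
elim: l => [w|e w mu l IH] /=.
  by rewrite lval_nil mulg1 mulgV; exact: (multiplicative1 to_hnn).
rewrite !to_hnnM IH to_hnn_vertex to_hnn_edge lval_cons /=.
by rewrite !mulgA !mulgVK.
Qed.

Lemma to_hnn_label (w : word X) : to_hnn (label T w) =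
  P (base w) * (lval (untype (lets w)) * eta (vinj (last_elt w))) * (P (base w))^-1.
Proof. by rewrite to_hnnM to_hnn_letters to_hnn_vertex !mulgA mulgVK. Qed.

End Comparison.

(** * Conjugacy in the fundamental group of a graph of groups *)

Section Conjugacy.
Variables (X : graph_of_groups) (T : set (geom_edge X)).
Local Notation G := (vprod X).
Local Notation nopinch := (@nopinch G (edge X) (@bar X) (@edge_assoc X)).
Local Notation teq := (@teq G (edge X) (@edge_assoc X)).
Local Notation eta := (@eta X).
Local Notation lval := (@lval G (edge X) (hnn X) eta (@stable X)).

(** No oriented edge is its own inverse. This settles cyclic words with one letter. *)
Lemma nopinch_refl x : nopinch x x.
Proof. by apply/asboolP; case: x => g [j b] [[] /esym/eqP]; case: b. Qed.

(** One rotation suffices: it makes the closing pair of the cyclic word adjacent. *)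
Lemma cycle_rot1 (s : seq (G * edge X)) :
  sorted nopinch s -> sorted nopinch (rot 1 s) -> cycle nopinch s.
Proof.
case: s => [|x s] //; rewrite rot1_cons.
by case: s => [|y s] /=; [rewrite nopinch_refl|move=> /andP[-> _]].
Qed.

Lemma cyclically_reduced_cycle (w : word X) : cyclically_reduced T w ->
  cycle nopinch (untype (lets w)).
Proof.
case: w => b l m [red]; rewrite /word_length /= => m1.
have [l0|l_gt0] := posnP (elength l).
  by move: l0; rewrite -size_untype => /size0nil ->.
have mE := m1 l_gt0; subst m.
have sorted_red b' (l' : letters b' b') : cyclic_conj (@Word X _ l 1) (@Word X _ l' 1) ->
    elength l' = elength l -> sorted nopinch (untype l').
  move=> /red; rewrite /reduced /word_length /= => + lE.
  by rewrite lE -[_ == 0%N]negbK -lt0n l_gt0 => /letters_reduced_sorted.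
apply: cycle_rot1; first by apply: sorted_red => //; exact: cyclic_conj_refl.
have [b' [l' [l'E cc]]] := cyclic_conj_rotation l 1.
by rewrite -l'E; apply: sorted_red cc _; rewrite -!size_untype l'E size_rot.
Qed.

(** Each [c_i] slides through [t_(e_i)], so the inner twists cancel and only the first and last
    remain. *)
Lemma twisted_label u v (a : vgroup u) (c : echain u v) (l l' : letters u v) :
  twisted a c l l' -> letters_label T l =
    gog_vertex T a * letters_label T l' * (gog_vertex T (chain_last c a))^-1.
Proof.
elim=> {u v a c l l'} [v a|e v a mu mu' c1 c l l' -> _ IH] /=.
  by rewrite mulg1 mulgV.
rewrite IH !gmulfM multiplicativeV !mulgA; congr (_ * _ * _).
rewrite -[_ * gog_edge T e * _]mulgA gog_edgeM !mulgA mulgVK.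
by [].
Qed.

(** The conjugacy is mapped to the HNN extension and solved there, then the answer is lifted back to
    typed words: [conj_cyclic_reduced] and [teq_twisted] for positive length, [hnn_conj_chain] for
    length 0. *)
Lemma gog_conjugacy (T_tree : maximal_tree T) (w w' : word X)
    (w_red : cyclically_reduced T w) (w'_red : cyclically_reduced T w')
    (ww' : conj_in (label T w) (label T w')) :
  word_length w = word_length w' /\
  [\/
      word_length w = 0%N /\
      exists (v : vertex X) (g g' : vgroup v),
        [/\ w = Word (enil _ v) g, w' = Word (enil _ v) g' & conj_in g g'],
      word_length w = 0%N /\
      exists (a b : vertex X) (g : vgroup a) (g' : vgroup b)
             (c : echain a b),
        [/\ (0 < elength c)%N,
            gog_vertex T g = label T w,
            gog_vertex T g' = label T w' &
            chain_conj c g g']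
    |
      (0 < word_length w)%N /\
      exists (v : vertex X) (l l' : letters v v) (c : echain v v),
        let w'' := Word l' 1 in
        let cn := chain_last c 1 in
        [/\ w = Word l 1, cyclic_conj w' w'', twisted cn c l l' &
            label T w =
              gog_vertex T cn * label T w'' * (gog_vertex T cn)^-1]].
Proof.
have [P P_tree] := tree_potential T_tree (base w).
pose F := @to_hnn X T P; have FM : {morph F : x y / x * y} := to_hnnM P_tree.
have [z zE] := ww'.
(* The potentials of the two base vertices are absorbed in the conjugator. *)
pose K := (P (base w))^-1 * F z * P (base w').
have KE : K * (lval (untype (lets w')) * eta (vinj (last_elt w'))) =
          lval (untype (lets w)) * eta (vinj (last_elt w)) * K.
  have : F z * F (label T w') = F (label T w) * F z.
    by rewrite zE -!FM conjgE mulVKg.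
  rewrite /F !(to_hnn_label P_tree) -/F => FE; rewrite /K.
  apply: (mulgI (P (base w))); apply: (mulIg (P (base w'))^-1).
  by rewrite !mulgA mulgV mul1g mulgK; rewrite !mulgA in FE.
have cw := cyclically_reduced_cycle w_red.
have cw' := cyclically_reduced_cycle w'_red.
have last1 (v : word X) : cyclically_reduced T v -> untype (lets v) != [::] ->
    last_elt v = 1.
  by move=> [_ v1]; rewrite -size_eq0 size_untype -lt0n => /v1.
have wlen : word_length w = word_length w'.
  rewrite /word_length -!size_untype.
  apply/esym/(conj_cyclic_size (@barK X) (@edge_assocV X) (@edge_assoc_fun X)
    (@stable_bar X) (@stable_assoc X) (@bseqval_surj X) (@bact_sound X) cw' cw _ _ KE).
    by move=> /(last1 _ w'_red) ->; rewrite multiplicative1.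
  by move=> /(last1 _ w_red) ->; rewrite multiplicative1.
split=> //; clearbody K; clear F FM ww' zE z.
have [w0|w_gt0] := posnP (word_length w); last first.
- apply: Or33; split=> //.
  have ul0 (v : word X) : word_length v = word_length w -> untype (lets v) != [::].
    by move=> vw; rewrite -size_eq0 size_untype -/(word_length v) vw -lt0n.
  have wE := last1 _ w_red (ul0 _ erefl).
  have w'E := last1 _ w'_red (ul0 _ (esym wlen)).
  have ul'0 := ul0 _ (esym wlen).
  case: w w' cw cw' wlen w_gt0 KE wE w'E ul'0 {w_red w'_red last1 ul0 P P_tree}
    => [b l m] [b' l' m'] /= cw cw' wlen l_gt0 + mE m'E ul'0; subst m m'.
  rewrite !multiplicative1 mulg1.
  have [z [k [sz ->]]] := reduced_exists (@barK X) (@edge_assoc_fun X)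
    (@stable_bar X) (@stable_assoc X) (@bseqval_surj X) K.
  have szl : (size (untype l) <= size (untype l'))%N.
    by move: wlen; rewrite !size_untype /word_length /= => ->.
  have sl : sorted nopinch (untype l).
    by case: (untype l) cw => //= x s; rewrite rcons_path => /andP[].
  rewrite mulg1 => KE.
  (* The word of [w'] plays the part of [x], so the rotation falls on [w']. *)
  have [|i [c]] := conj_cyclic_reduced (@barK X) (@edge_assocV X) (@stable_bar X)
    (@stable_assoc X) (@bact_sound X) (m := k) (b := 1) sz ul'0 cw' sl szl.
    by rewrite multiplicative1 mulg1.
  rewrite mul1g; have [v [l'' [<- cc]]] := cyclic_conj_rotation l' i.
  case lE : (untype l) => [|[g e] L]; first by move: l_gt0; rewrite /word_length /= -size_untype lE.
  case l''E : (untype l'') => [|[g'' e''] L''] //= tl.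
  (* Twisted words start with the same edge, hence at the same vertex. *)
  have bv : b = v.
    have [eb _] := untype_cons lE; have [ev _] := untype_cons l''E.
    by rewrite -eb -ev; case: tl => ->.
  (* The twist [c] also appears at the end of the loop, as an element of the group of the vertex
     where the loop closes. *)
  subst v; have [a aE] : exists a : vgroup b, c = vinj a.
    have [h [mu [l1 [_ _ LE]]]] := untype_cons lE.
    case: tl => _ [p [q [[d [-> _]] _]]]; rewrite LE => /teq_last_vinj[a].
    by rewrite mulg1 => ->; exists a.
  have : teq (vinj a) (untype l) (vinj a) (untype l'') 1.
    by rewrite lE l''E -aE.
  move=> /teq_twisted[d [dl tw aE']].
  (* The twist comes back to itself after one turn, so [c_n^+] is the initial twist [a]. *)
  have d_last : chain_last d a = a by apply: vinj_inj; rewrite -[LHS]mulg1 -aE'.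
  have d1 : chain_last d 1 = a.
    by rewrite -[RHS]d_last; apply: chain_last_pos; rewrite dl.
  exists b, l, l'', d; rewrite d1; split=> //.
  by rewrite /label /= !multiplicative1 !mulg1 (twisted_label tw) d_last.
- case: w w' w_red w'_red wlen w0 KE {last1 cw cw' P P_tree}
    => [a l g] [b l' g'] [red _] _ /=; rewrite /word_length /= => + l0.
  rewrite l0 => /esym l'0; rewrite (elength0_loop l0) (elength0_loop l'0) /=.
  rewrite !lval_nil !mul1g => KE.
  (* A reduced word of length 0 has a nontrivial label. *)
  have g1 : g <> 1.
    move=> g1; have := red _ (cyclic_conj_refl _).
    rewrite /reduced /word_length /= l0 /= => -[].
    by rewrite /label /= g1 (elength0_loop l0) /= mul1g multiplicative1.
  (* [K] carries [g'] to [g]; its inverse makes the chain run from [w] to [w']. *)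
  have [s [m [ss KE']]] := reduced_exists (@barK X) (@edge_assoc_fun X)
    (@stable_bar X) (@stable_assoc X) (@bseqval_surj X) K^-1.
  have [|c cc] := hnn_conj_chain ss g1 (g' := g') (m := m).
    by rewrite -KE'; apply: (mulgI K); apply: (mulIg K); rewrite !mulgA mulgV mul1g mulgVK.
  (* An empty chain means conjugacy inside one vertex group. *)
  have [c0|c_gt0] := posnP (elength c).
    apply: Or31; split=> //; have [ab] := elength0 c0.
    case: _ / ab c g' KE cc c0 => c g' _ cc c0 cE; exists a, g, g'; split=> //.
    by move: cc; rewrite cE.
  apply: Or32; split=> //; exists a, b, g, g', c; split=> //; by rewrite /label /= mul1g.
Qed.

End Conjugacy.

(** * Transfer to the fundamental group of the manifold *)

Theorem theorem3p1 (R : realType) (M : topologicalType)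
    (M_haken : closed_haken R M)
    (W : torus_system R M) (W_jsj : jsj W) (X : jsj_graph W)
    (T : set (geom_edge (jsj_gog X))) (T_tree : maximal_tree T)
    (x0 : [set: M]%classic)
    (Phi : {multiplicative pi1_gog T -> pi1 R x0})
    (Phi_id : identification Phi)
    (w w' : word (jsj_gog X))
    (w_red : cyclically_reduced T w) (w'_red : cyclically_reduced T w')
    (ww' : conj_in (Phi (label T w)) (Phi (label T w'))) :
  word_length w = word_length w' /\
  [\/
      word_length w = 0%N /\
      exists (v : vertex (jsj_gog X)) (g g' : vgroup v),
        [/\ w = Word (enil _ v) g, w' = Word (enil _ v) g' & conj_in g g'],
      word_length w = 0%N /\
      exists (a b : vertex (jsj_gog X)) (g : vgroup a) (g' : vgroup b)
             (c : echain a b),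
        [/\ (0 < elength c)%N,
            Phi (gog_vertex T g) = Phi (label T w),
            Phi (gog_vertex T g') = Phi (label T w') &
            chain_conj c g g']
    |
      (0 < word_length w)%N /\
      exists (v : vertex (jsj_gog X)) (l l' : letters v v) (c : echain v v),
        let w'' := Word l' 1 in
        let cn := chain_last c 1 in
        [/\ w = Word l 1, cyclic_conj w' w'', twisted cn c l l' &
            Phi (label T w) =
              Phi (gog_vertex T cn) * Phi (label T w'') *
              (Phi (gog_vertex T cn))^-1]].
Proof.
have [[Psi PhiK PsiK] _] := Phi_id.
have [z zE] := ww'.
(* Since [Phi] is bijective, the conjugator is pulled back by its inverse [Psi]. *)
have lww' : conj_in (label T w) (label T w').
  exists (Psi z); apply: (can_inj PhiK).
  by rewrite zE !conjgE !gmulfM multiplicativeV PsiK.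
have [wlen [[w0 i]|[w0 [a [b [g [g' [c [c0 gE g'E cc]]]]]]]|[w0 [v [l [l' [c [wE cw tw lE]]]]]]]] :=
  gog_conjugacy T_tree w_red w'_red lww'; split=> //.
- by apply: Or31.
- by apply: Or32; split=> //; exists a, b, g, g', c; rewrite gE g'E.
- apply: Or33; split=> //; exists v, l, l', c; split=> //.
  by rewrite lE !gmulfM multiplicativeV.
Qed.
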